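(* Let $(G,\rho)$ be a stationary random graph of weakly annealed polynomial growth. Then for every $\varepsilon>0$ there is a constant $C>0$ and an infinite strictly increasing (deterministic) sequence of times $\{t_n\}_{n\ge1}$ of positive integers such that for every $n\ge 1$, $$H_{t_n}-H_{t_n-1}\le \frac{C}{t_n}\qquad\text{and}\qquad \Pr\left(\mathbb{E}\left[d_G(X_0,X_{t_n})^2\mid (G,\rho)\right]\le C t_n\right)\ge 1-\varepsilon .$$
   Context: A random rooted graph $(G,\rho)$ is a random variable with values in the (isomorphism classes of) rooted graphs; $G$ is assumed locally finite and almost surely connected. $V_G$ is the vertex set, $d_G$ the graph metric, and $B^G_x(r)=\{y\in V_G: d_G(x,y)\le r\}$. Conditioned on $(G,\rho)$, $\{X_n\}_{n\ge 0}$ is the simple random walk on $G$ with $X_0=\rho$; $\mathbb{E}[\cdot\mid(G,\rho)]$ averages over the walk only, and the outer probability is over $(G,\rho)$. $(G,\rho)$ is stationary if $(G,X_0)$ and $(G,X_1)$ have the same law. $(G,\rho)$ has weakly annealed polynomial growth if there are constants $c,s\ge 0$ such that for all $r\ge 1$, $\mathbb{E}[\log |B^G_\rho(r)|]\le s\log r + c$. The annealed entropy is $H_n=\mathbb{E}[H_{(G,\rho)}(n)]$, where $H_{(G,\rho)}(n)=\sum_{x\in V_G}\Pr[X_n=x\mid(G,\rho)]\log\frac{1}{\Pr[X_n=x\mid (G,\rho)]}$ (with $0\log 0=0$) is the entropy of $X_n$ conditioned on $(G,\rho)$. *)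

(* Defs.v *)
From HB Require Import structures.
From mathcomp Require Import all_boot all_order all_algebra.
From mathcomp Require Import finmap.
From mathcomp Require Import all_classical all_reals all_analysis.

Set Implicit Arguments.
Unset Strict Implicit.
Unset Printing Implicit Defensive.

Import Order.TTheory GRing.Theory Num.Theory.

Local Open Scope classical_set_scope.
Local Open Scope ring_scope.

(* Simple graphs.  A connected locally finite graph is countable, so taking the
   vertices in nat loses no generality. *)
Record graph := Graph {
  vertex_pred : pred nat ;
  adj : rel {x : nat | vertex_pred x} ;
  adj_sym : symmetric adj ;
  adj_irr : irreflexive adj ;
  adj_locally_finite : forall x, finite_set [set y | adj x y] }.

Definition vertex (g : graph) : countType := {x : nat | vertex_pred g x}.

Record rooted_graph := RootedGraph {
  graph_of :> graph ;
  root : vertex graph_of }.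

Definition connected_graph (g : graph) : Prop :=
  forall x y : vertex g, exists2 p, path (@adj g) x p & last x p = y.

(* [dist_le x y r] says that the graph distance from x to y is at most r. *)
Definition dist_le (g : graph) (x y : vertex g) (r : nat) : Prop :=
  exists p, [/\ path (@adj g) x p, last x p = y & (size p <= r)%N].

(* The graph metric; it is +oo between distinct connected components. *)
Definition gdist (R : realType) (g : graph) (x y : vertex g) : \bar R :=
  ereal_inf [set (r%:R)%:E | r in dist_le x y].

Definition gball (g : graph) (x : vertex g) (r : nat) : set (vertex g) :=
  [set y | dist_le x y r].

Definition ball_iso (r : nat) (g h : rooted_graph) : Prop :=
  exists f : vertex g -> vertex h,
    [/\ set_bij (gball (root g) r) (gball (root h) r) f,
        f (root g) = root h
      & {in gball (root g) r &, forall x y, adj (f x) (f y) = adj x y}].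

Fact point_adj_sym : symmetric (fun _ _ : {x : nat | pred1 0%N x} => false).
Proof. by []. Qed.
Fact point_adj_irr : irreflexive (fun _ _ : {x : nat | pred1 0%N x} => false).
Proof. by []. Qed.
Fact point_adj_locally_finite (x : {x : nat | pred1 0%N x}) :
  finite_set [set y : {x : nat | pred1 0%N x} | false].
Proof. by rewrite (_ : [set y | _] = set0) //; apply/seteqP; split. Qed.

Definition point_graph : rooted_graph :=
  @RootedGraph (Graph point_adj_sym point_adj_irr point_adj_locally_finite)
    (exist _ 0%N (eqxx 0%N)).

HB.instance Definition _ := gen_eqMixin rooted_graph.
HB.instance Definition _ := gen_choiceMixin rooted_graph.
HB.instance Definition _ := isPointed.Build rooted_graph point_graph.

(* The events "B_rho(r) is isomorphic to the r-ball of h" are a countable basis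
   of the local topology on rooted graphs, so they generate its Borel
   sigma-algebra.  Every event is invariant under rooted isomorphism: a random
   variable with values in [rg_space] is a random variable with values in
   isomorphism classes, together with a choice of representatives that need not
   be measurable with respect to vertex labels. *)
Definition local_events : set (set rooted_graph) :=
  [set [set g | ball_iso r h g] | r in [set: nat] & h in [set: rooted_graph]].

Definition rg_space := g_sigma_algebraType local_events.

Definition reroot (g : rooted_graph) (x : vertex g) : rooted_graph :=
  RootedGraph x.

Section random_walk.
Context {R : realType}.

Definition degree (g : graph) (x : vertex g) : nat :=
  #|` fset_set [set y | adj x y] |.

(* At an isolated vertex the walk stays put. *)
Definition step_prob (g : graph) (x y : vertex g) : R :=
  if degree x == 0%N then (x == y)%:R
  else if adj x y then (degree x)%:R^-1 else 0.

(* For x a vertex of g, [walk_prob n x] is Pr[X_n = x | (G, rho) = g].  The sum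
   has finitely many nonzero terms, because g is locally finite. *)
Fixpoint walk_prob (g : rooted_graph) (n : nat) (x : vertex g) {struct n} : R :=
  if n is m.+1 then
    \sum_(y \in [set: vertex g]) @walk_prob g m y * step_prob y x
  else (x == root g)%:R.

(* E[d_G(X_0, X_n)^2 | (G, rho) = g] *)
Definition mean_sq_displacement (g : rooted_graph) (n : nat) : \bar R :=
  \esum_(x in [set: vertex g])
    ((walk_prob n x)%:E * gdist R (root g) x ^+ 2)%E.

(* Terms with walk_prob n x = 0 vanish, whatever the value of ln 0^-1. *)
Definition quenched_entropy (g : rooted_graph) (n : nat) : \bar R :=
  \esum_(x in [set: vertex g])
    (walk_prob n x * ln (walk_prob n x)^-1)%:E.

Context {d : measure_display} {Omega : measurableType d}.
Variables (P : probability Omega R) (G : Omega -> rg_space).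

(* The law of (G, X_n), as a function of events. *)
Definition walk_law (n : nat) (A : set rg_space) : \bar R :=
  (\int[P]_w \esum_(x in [set: vertex (G w)])
    (walk_prob n x * \1_A (reroot x))%:E)%E.

Definition stationary : Prop :=
  forall A : set rg_space, measurable A -> walk_law 0 A = walk_law 1 A.

Definition weakly_annealed_polynomial_growth : Prop :=
  exists c s : R, [/\ 0 <= c, 0 <= s &
    forall r : nat, (1 <= r)%N ->
      (\int[P]_w (ln (#|` fset_set (gball (root (G w)) r) |%:R))%:E
         <= (s * ln r%:R + c)%:E)%E].

Definition annealed_entropy (n : nat) : \bar R :=
  (\int[P]_w quenched_entropy (G w) n)%E.

End random_walk.

(* Main.v *)
Require Import Defs.
From HB Require Import structures.
From mathcomp Require Import all_boot all_order all_algebra.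
From mathcomp Require Import finmap.
From mathcomp Require Import all_classical all_reals all_analysis.
From mathcomp Require Import measurable_realfun.
From mathcomp Require Import lra zify.

Set Implicit Arguments.
Unset Strict Implicit.
Unset Printing Implicit Defensive.

Import Order.TTheory GRing.Theory Num.Theory.

Local Open Scope classical_set_scope.
Local Open Scope ring_scope.

(** Nash's entropy argument gives the theorem directly, and even the stronger
    bound E[d(X_0, X_t)^2] = O(t), averaged over the graph, along the chosen
    times.

    Fix a rooted graph.  The walk is reversible with respect to the degree, so
    the densities q_n(x) = p_n(x) / deg x obey q_(n+1) = K q_n for the
    averaging operator K of the walk.  Let M_n be the mean square displacement
    and let Q_n = - sum_x p_n(x) ln q_n(x), the entropy relative to the degree.
    Then
      M_(n+2) - M_n
        = sum_(x ~ y) (d(x)^2 - d(y)^2) (q_n(y) - q_(n+1)(x));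
    the two steps make the right-hand side a pairing of the gradient of d^2
    with the fluctuation of q_n around its local average q_(n+1), whatever the
    periodicity of the walk.  That fluctuation is controlled by the entropy
    production h_n = Q_(n+1) - Q_n >= 0, which is the Jensen gap of t ln t.
    Since |d(x) - d(y)| <= 1 on edges, Cauchy-Schwarz yields [nash_step];
    summed over time this is
      M_n <= 2 + 32 sqrt n * sum_(k < n) sqrt (k+1) h_k
    ([mean_sq_dist_le]).

    The bound is linear in the h_k, so it can be averaged over the random
    graph.  Stationarity makes E[ln deg X_n] independent of n, hence
    E[h_n] = H_(n+1) - H_n ([integral_entropy_gain]), and polynomial growth
    bounds the sum of these increments up to n by H_n <= s ln n + c.  A
    nonnegative sequence whose partial sums grow logarithmically satisfies,
    for arbitrarily large t, both t h_(t-1) <= C and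
    sum_(k < t) sqrt (k+1) h_k <= C sqrt t ([exists_good_times]).  At such
    times the entropy increment is O(1/t) and E[M_t] = O(t); Markov's
    inequality concludes.

    Measurability comes from locality: a quantity that depends only on the
    isomorphism class of a ball of fixed radius takes countably many values,
    each on a countable union of the generating events
    ([local_measurable]). *)

(** * Real sequences *)

Lemma sum_inv_sqrt_le (R : realType) (N : nat) :
  \sum_(k < N) (Num.sqrt k.+1%:R)^-1 <= 2 * Num.sqrt N%:R :> R.
Proof.
elim: N => [|N IH]; first by rewrite big_ord0 sqrtr0 mulr0.
rewrite big_ord_recr /=.
apply: le_trans (lerD IH (lexx _)) _.
set a := Num.sqrt N%:R; set b := Num.sqrt N.+1%:R.
have a0 : 0 <= a by exact: sqrtr_ge0.
have b0 : 0 < b by rewrite sqrtr_gt0 ltr0n.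
have a2 : a ^+ 2 = N%:R by rewrite sqr_sqrtr// ler0n.
have b2 : b ^+ 2 = N%:R + 1 by rewrite sqr_sqrtr ?ler0n// natr1.
rewrite -(ler_pM2r b0) mulrDl mulVf ?gt_eqF//.
have := sqr_ge0 (b - a); nra.
Qed.

(** The bound is affine in [h] because the step inequality may be used with a
    different [lam] at each time.  With [lam] = 32 sqrt (N (k+1)) at time k,
    the terms involving [M] add up to at most half of the maximum of [M] over
    [0, N], and are absorbed. *)
Lemma moment_growth (R : realType) (M h : nat -> R) :
  (forall n, 0 <= M n) -> (forall n, 0 <= h n) -> M 0%N <= 1 -> M 1%N <= 1 ->
  (forall n (lam : R), 0 < lam -> M n.+2 - M n <=
     lam / 2 * h n + 2 / lam * (M n + 2 * M n.+1 + M n.+2)) ->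
  forall N, M N <=
    2 + 32 * Num.sqrt N%:R * \sum_(k < N) Num.sqrt k.+1%:R * h k.
Proof.
move=> M0 h0 M01 M11 step [|N'].
  by rewrite big_ord0 mulr0 addr0; lra.
set N := N'.+1; set Y := \sum_(k < N) _.
set sN := Num.sqrt N%:R.
have sN0 : 0 < sN by rewrite sqrtr_gt0 ltr0n.
pose D : R := \big[Num.max/0]_(k < N.+1) M k.
have MD k : (k <= N)%N -> M k <= D.
  by move=> kN; 
     exact: (le_bigmax _ (fun i : 'I_N.+1 => M i) (Ordinal (kN : (k < N.+1)%N))).
have D0 : 0 <= D by apply: le_trans (M0 0%N) (MD _ _).
pose a k : R := Num.sqrt k.+1%:R.
have a0 k : 0 < a k by rewrite sqrtr_gt0 ltr0n.
pose b k : R := 16 * sN * (a k * h k) + D / (4 * sN) * (a k)^-1.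
have b0 k : 0 <= b k.
  apply: addr_ge0; first by rewrite !mulr_ge0// ltW.
  by rewrite !mulr_ge0 ?invr_ge0 ?mulr_ge0 ?(ltW (a0 _)) ?(ltW sN0).
have stepb k : (k.+2 <= N)%N -> M k.+2 <= M k + b k.
  move=> kN; have lam0 : 0 < 32 * sN * a k by rewrite !mulr_gt0.
  have := step k _ lam0.
  have -> : 32 * sN * a k / 2 * h k = 16 * sN * (a k * h k) by lra.
  rewrite lerBlDl => /le_trans; apply.
  rewrite /b lerD2l lerD2l !invfM.
  have i0 : 0 < sN^-1 * (a k)^-1 by rewrite mulr_gt0 ?invr_gt0.
  rewrite (_ : D * (4^-1 * sN^-1) * (a k)^-1 =
    2 * (32^-1 * sN^-1 * (a k)^-1) * (4 * D)); last by lra.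
  apply: ler_wpM2l; first by lra.
  have := MD _ kN; have := MD _ (ltnW kN); have := MD _ (ltnW (ltnW kN)); lra.
have Mb n : (n <= N)%N -> M n <= 1 + \sum_(k < n) b k.
  have [m] := ubnP n; elim: m n => // m IH [|[|n]] nm nN.
  - by rewrite big_ord0 addr0.
  - by apply: le_trans M11 _; rewrite lerDl sumr_ge0.
  - apply: le_trans (stepb n nN) _; rewrite !big_ord_recr /=.
    have := IH n (ltn_trans (ltnSn _) nm) (ltnW (ltnW nN)).
    have := b0 n.+1; lra.
have sb n : (n <= N)%N -> \sum_(k < n) b k <= \sum_(k < N) b k.
  move=> nN; rewrite -!(big_mkord xpredT b) (@big_cat_nat _ _ _ n 0 N)//= lerDl.
  by rewrite sumr_ge0.
have DN : D <= 1 + \sum_(k < N) b k.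
  apply/bigmax_leP; split=> [|k _]; first by rewrite addr_ge0// sumr_ge0.
  have kN : (k <= N)%N by rewrite -ltnS.
  by apply: le_trans (Mb _ kN) _; rewrite lerD2l sb.
have : \sum_(k < N) b k <= 16 * sN * Y + D / 2.
  rewrite big_split /= -!mulr_sumr lerD2l.
  have := sum_inv_sqrt_le R N; rewrite -/sN => sl.
  have -> : D / 2 = D / (4 * sN) * (2 * sN).
    rewrite invfM (_ : D * (4^-1 / sN) * (2 * sN) = (sN / sN) * (D / 2)); last by lra.
    by rewrite mulfV ?lt0r_neq0// mul1r.
  by apply: ler_wpM2l => //; rewrite divr_ge0// ?mulr_ge0// ltW.
have := MD N (leqnn _); lra.
Qed.

Lemma ln_succ_le (R : realType) (n : nat) :
  ln (n.+2%:R : R) <= ln n.+1%:R + n.+1%:R^-1.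
Proof.
have n0 : 0 < n.+1%:R :> R by rewrite ltr0n.
have -> : n.+2%:R = n.+1%:R * (1 + n.+1%:R^-1) :> R.
  by rewrite mulrDr mulr1 mulfV ?gt_eqF// natr1.
rewrite lnM ?posrE// ?addr_gt0 ?invr_gt0// lerD2l.
by apply: le_ln1Dx; rewrite (lt_trans (ltrN10 _))// invr_gt0.
Qed.

(** The potential B_t = (sum_(k < t) sqrt (k+1) h_k) / sqrt t gains at most
    h_t at each step and loses a fraction 1/(2(t+1)) of itself.  If every
    large t were bad, then C / (4(t+1)) <= 2 h_t + B_t - B_(t+1) would hold
    for large t; summing up to N, (C / 4) ln N would be at most
    2 (s ln N + c) plus a constant, which fails for large N as C / 4 > 2 s. *)
Lemma exists_good_times (R : realType) (h : nat -> R) (s c : R) :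
  0 <= s -> (forall k, 0 <= h k) ->
  (forall N, (0 < N)%N -> \sum_(k < N) h k <= s * ln N%:R + c) ->
  exists2 C, 0 < C & forall T : nat, exists t : nat, [/\ (T <= t)%N,
    t.+1%:R * h t <= C &
    \sum_(k < t.+1) Num.sqrt k.+1%:R * h k <= C * Num.sqrt t.+1%:R].
Proof.
move=> s0 h0 hsum.
pose A t : R := \sum_(k < t) Num.sqrt k.+1%:R * h k.
pose B t : R := A t / Num.sqrt t%:R.
pose C := 8 * s + 4.
have C0 : 0 < C by rewrite /C; lra.
exists C => // T; apply: contrapT => noT.
have A0 t : 0 <= A t by apply: sumr_ge0 => k _; rewrite mulr_ge0// sqrtr_ge0.
have B0 t : 0 <= B t by rewrite divr_ge0// sqrtr_ge0.
have Bstep t : (0 < t)%N ->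
    B t.+1 <= B t + h t /\ B t / (2 * t.+1%:R) <= h t + B t - B t.+1.
  move=> t0.
  set a := Num.sqrt (t%:R : R); set b := Num.sqrt (t.+1%:R : R).
  have ap : 0 < a by rewrite sqrtr_gt0 ltr0n.
  have bp : 0 < b by rewrite sqrtr_gt0 ltr0n.
  have a2 : a ^+ 2 = t%:R by rewrite sqr_sqrtr// ler0n.
  have b2 : t.+1%:R = b ^+ 2 by rewrite sqr_sqrtr// ler0n.
  have ab : b ^+ 2 = a ^+ 2 + 1 by rewrite -b2 a2 natr1.
  have BE : B t.+1 = B t * (a / b) + h t.
    rewrite /B /A big_ord_recr /= -/(A t) -/a -/b.
    rewrite mulrDl; congr (_ + _); last by rewrite mulrAC mulfV ?mul1r ?lt0r_neq0.
    by rewrite mulrA divfK ?lt0r_neq0.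
  have q : a / b <= 1 - (2 * b ^+ 2)^-1.
    rewrite -(ler_pM2r (_ : 0 < 2 * b ^+ 2)) ?mulr_gt0 ?exprn_gt0//.
    rewrite mulrBl mulVf ?mul1r ?gt_eqF ?mulr_gt0 ?exprn_gt0//.
    have -> : a / b * (2 * b ^+ 2) = 2 * a * b.
      rewrite (_ : _ * _ = (b / b) * (2 * a * b)); last by lra.
      by rewrite mulfV ?lt0r_neq0// mul1r.
    have := sqr_ge0 (b - a); nra.
  have Bq : B t * (a / b) <= B t - B t / (2 * b ^+ 2).
    by rewrite -{2}[B t]mulr1 -mulrBr; apply: ler_wpM2l.
  have Bb : 0 <= B t / (2 * b ^+ 2).
    by rewrite divr_ge0// mulr_ge0// sqr_ge0.
  rewrite b2 BE; split; lra.
(* If B_t < C/2 and h_t < C/(4(t+1)), then t is good, as B_(t+1) <= B_t + h_t. *)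
have badt t : (T.+1 <= t)%N -> C / 4 * t.+1%:R^-1 <= 2 * h t + B t - B t.+1.
  move=> Tt.
  have t1 : 0 < t.+1%:R :> R by rewrite ltr0n.
  have [Bs1 Bs2] := Bstep t (leq_trans (ltn0Sn T) Tt).
  have Bs3 : B t / 2 * t.+1%:R^-1 <= h t + B t - B t.+1.
    by move: Bs2; rewrite invfM mulrA.
  have i1 : 0 < t.+1%:R^-1 :> R by rewrite invr_gt0.
  have i2 : t.+1%:R^-1 <= 1 :> R by rewrite invf_le1// ler1n.
  set i : R := t.+1%:R^-1 in Bs3 i1 i2 *.
  have [Bbig|Bsmall] := lerP (C / 2) (B t).
    have l1 : C / 4 * i <= B t / 2 * i by rewrite ler_pM2r//; lra.
    apply: le_trans l1 (le_trans Bs3 _); have := h0 t; lra.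
  have [hbig|hsmall] := lerP (C / 4 * i) (h t).
    apply: le_trans hbig _; have : 0 <= B t / 2 * i.
      by rewrite mulr_ge0 ?divr_ge0// ltW.
    have := h0 t; lra.
  exfalso; apply: noT; exists t; split; first exact: ltnW.
  - move: hsmall; rewrite ltr_pdivlMr// => hs; rewrite mulrC.
    by apply: le_trans (ltW hs) _; lra.
  - rewrite -ler_pdivrMr; last by rewrite sqrtr_gt0.
    rewrite -/(A t.+1) -/(B t.+1); apply: le_trans Bs1 _.
    have : C / 4 * i <= C / 4 by rewrite ler_piMr//; lra.
    lra.
have tel N : C / 4 * (ln (T + N).+2%:R - ln T.+2%:R) <=
    2 * \sum_(k < N) h (T.+1 + k)%N + B T.+1 - B (T.+1 + N)%N.
  elim: N => [|N IH]; first by rewrite !addn0 big_ord0 !subrr !mulr0 add0r subrr.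
  rewrite big_ord_recr /= !addnS.
  have := badt (T.+1 + N)%N (leq_addr _ _); rewrite addSn.
  have := ln_succ_le R (T + N).+1.
  rewrite -subr_ge0 => l1 l2.
  have l3 : 0 <= C / 4 * (ln (T + N).+2%:R + ((T + N).+2)%:R^-1 - ln (T + N).+3%:R).
    by rewrite mulr_ge0//; lra.
  move: IH l3 l2; rewrite addSn !mulrBr !mulrDr.
  move: (C / 4 * _) (C / 4 * _) (C / 4 * _) (C / 4 * _) => u1 u2 u3 u4; lra.
(* Beyond this size of ln N, the telescoped inequality is violated. *)
pose K := 2 * c + B T.+1 + C / 4 * ln T.+2%:R.
pose N := (Num.truncn (expR K)).+1.
have := tel N.
have hN : \sum_(k < N) h (T.+1 + k)%N <= s * ln (T + N).+2%:R + c.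
  apply: le_trans (hsum (T + N).+2 _); last by [].
  have -> : \sum_(k < (T + N).+2) h k =
      \sum_(k < T.+1) h k + (\sum_(k < N) h (T.+1 + k)%N + h (T.+1 + N)%N).
    rewrite (_ : (T + N).+2 = (T.+1 + N.+1)%N); last by lia.
    by rewrite big_split_ord /= (big_ord_recr N).
  rewrite addrCA lerDl addr_ge0//; exact: sumr_ge0.
have lK : K < ln (T + N).+2%:R.
  rewrite -[K]expRK ltr_ln ?posrE ?expR_gt0 ?ltr0n//.
  apply: lt_le_trans (Num.Theory.truncnS_gt _) _; rewrite ler_nat -/N.
  by apply: leq_trans (leq_addl T N) _; rewrite -addn2 leq_addr.
have := B0 (T.+1 + N)%N; move: lK; rewrite /K /C.
lra.
Qed.

(** * Nash's inequality for a reversible Markov chain *)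

(** The Jensen gap of t ln t dominates a squared Hellinger distance, since
    ln (b / a) <= b / a - 1 for a = sqrt u and b = sqrt v. *)
Lemma sqrt_gap (R : realType) (u v : R) : 0 <= u -> 0 <= v ->
  (v = 0 -> u = 0) ->
  (Num.sqrt u - Num.sqrt v) ^+ 2 <= u * (ln u - ln v) - u + v.
Proof.
move=> u0 v0 uv.
have [->|un0] := eqVneq u 0.
  by rewrite sqrtr0 sub0r sqrrN sqr_sqrtr// mul0r subr0 add0r.
have vn0 : v != 0 by apply: contra_neq un0.
have up : 0 < u by rewrite lt_neqAle eq_sym un0.
have vp : 0 < v by rewrite lt_neqAle eq_sym vn0.
set a := Num.sqrt u; set b := Num.sqrt v.
have ap : 0 < a by rewrite sqrtr_gt0.
have bp : 0 < b by rewrite sqrtr_gt0.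
have ua : u = a ^+ 2 by rewrite sqr_sqrtr.
have vb : v = b ^+ 2 by rewrite sqr_sqrtr.
have : ln (b / a) <= b / a - 1.
  have := @le_ln1Dx R (b / a - 1).
  by rewrite addrCA subrr addr0; apply; rewrite ltrBrDl subrr divr_gt0.
rewrite lnM ?posrE ?invr_gt0// lnV ?posrE// => hl.
rewrite ua vb !lnXn//.
have : a ^+ 2 * (ln b - ln a) <= a ^+ 2 * (b / a - 1).
  by apply: ler_wpM2l; rewrite ?sqr_ge0.
have -> : a ^+ 2 * (b / a - 1) = a * b - a ^+ 2.
  rewrite (_ : _ * _ = (a / a) * (a * b) - a ^+ 2); last by lra.
  by rewrite mulfV ?lt0r_neq0// mul1r.
rewrite !mulr2n; nra.
Qed.

(** This is X Z <= lam/2 X^2 + Z^2/(2 lam) for the factorization of the left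
    side into X = (dx - dy)(sqrt u - sqrt v) and
    Z = (dx + dy)(sqrt u + sqrt v). *)
Lemma nash_pointwise (R : realType) (dx dy u v lam : R) :
  0 < lam -> 0 <= u -> 0 <= v -> (u != 0 \/ v != 0 -> `|dx - dy| <= 1) ->
  (dx ^+ 2 - dy ^+ 2) * (u - v) <= lam / 2 * (Num.sqrt u - Num.sqrt v) ^+ 2 +
    2 / lam * ((dx ^+ 2 + dy ^+ 2) * (u + v)).
Proof.
move=> lam0 u0 v0 dxy.
have [/andP[/eqP-> /eqP->]|uv] := boolP ((u == 0) && (v == 0)).
  by rewrite sqrtr0 !(subrr, addr0, mulr0, expr0n).
have : `|dx - dy| <= 1 by apply: dxy; move: uv; rewrite negb_and => /orP.
rewrite ler_norml => /andP[l1 l2].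
set a := Num.sqrt u; set b := Num.sqrt v.
have -> : u = a ^+ 2 by rewrite sqr_sqrtr.
have -> : v = b ^+ 2 by rewrite sqr_sqrtr.
set X := (dx - dy) * (a - b); set Z := (dx + dy) * (a + b).
have -> : (dx ^+ 2 - dy ^+ 2) * (a ^+ 2 - b ^+ 2) = X * Z by rewrite /X /Z; lra.
have XZ : X * Z <= lam / 2 * X ^+ 2 + (2 * lam)^-1 * Z ^+ 2.
  have -> : lam / 2 * X ^+ 2 + (2 * lam)^-1 * Z ^+ 2 =
      X * Z + (2 * lam)^-1 * (lam * X - Z) ^+ 2.
    rewrite invfM (_ : X * Z + _ = lam / 2 * (lam / lam) * X ^+ 2 +
      2^-1 * lam^-1 * Z ^+ 2 + (1 - lam / lam) * (X * Z)); last by lra.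
    by rewrite mulfV ?lt0r_neq0// subrr mul0r addr0 mulr1.
  by rewrite lerDl mulr_ge0 ?sqr_ge0// invr_ge0 mulr_ge0// ltW.
apply: le_trans XZ _; apply: lerD.
  apply: ler_wpM2l; first by rewrite divr_ge0// ltW.
  by rewrite /X exprMn ler_piMl ?sqr_ge0//; nra.
have -> : 2 / lam = (2 * lam)^-1 * 4 by rewrite invfM; lra.
rewrite -mulrA; apply: ler_wpM2l; first by rewrite invr_ge0 mulr_ge0// ltW.
have S2 : (dx + dy) ^+ 2 <= 2 * (dx ^+ 2 + dy ^+ 2).
  by have := sqr_ge0 (dx - dy); nra.
have ab2 : (a + b) ^+ 2 <= 2 * (a ^+ 2 + b ^+ 2) by have := sqr_ge0 (a - b); nra.
rewrite exprMn; apply: le_trans (ler_pM (sqr_ge0 _) (sqr_ge0 _) S2 ab2) _.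
by rewrite le_eqVlt; apply/orP; left; apply/eqP; lra.
Qed.

Section nash.
Context (R : realType) (V : Type) (B : seq V) (w : V -> V -> R) (mu D : V -> R).
Variables (q0 q1 q2 : V -> R).
Hypotheses (w_ge0 : forall x y, 0 <= w x y) (w_sym : forall x y, w x y = w y x).
Hypothesis D_lip : forall x y, w x y != 0 -> q0 y != 0 \/ q1 y != 0 -> `|D x - D y| <= 1.
Hypotheses (q0_ge0 : forall x, 0 <= q0 x) (q1_ge0 : forall x, 0 <= q1 x).
Hypothesis q1E : forall x, mu x * q1 x = \sum_(y <- B) w x y * q0 y.
Hypothesis q2E : forall x, mu x * q2 x = \sum_(y <- B) w x y * q1 y.
Hypothesis mu_q0 : forall x, \sum_(y <- B) w x y * q0 x = mu x * q0 x.
Hypothesis mu_q1 : forall x, \sum_(y <- B) w x y * q1 x = mu x * q1 x.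
Hypothesis q1_eq0 : forall x y, w x y != 0 -> q1 x = 0 -> q0 y = 0.

Let Q q := \sum_(x <- B) mu x * q x * ln (q x).
Let M q := \sum_(x <- B) mu x * q x * D x ^+ 2.

(** Grouping the Jensen gaps by the vertex x where q0 is averaged, and using
    symmetry of [w] to see that the terms linear in the densities cancel, the
    right side is the total of the gaps of [sqrt_gap]. *)
Lemma hellinger_le_entropy :
  \sum_(x <- B) \sum_(y <- B) w x y * (Num.sqrt (q0 y) - Num.sqrt (q1 x)) ^+ 2
  <= Q q0 - Q q1.
Proof.
have -> : Q q0 - Q q1 = \sum_(x <- B) \sum_(y <- B)
    w x y * (q0 y * (ln (q0 y) - ln (q1 x)) - q0 y + q1 x).
  have -> : Q q0 = \sum_(x <- B) \sum_(y <- B) w x y * q0 y * ln (q0 y).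
    rewrite exchange_big /=; apply: eq_bigr => x _.
    rewrite -mu_q0 mulr_suml; apply: eq_bigr => y _.
    by rewrite (w_sym x y).
  have -> : Q q1 = \sum_(x <- B) \sum_(y <- B) w x y * q0 y * ln (q1 x).
    by apply: eq_bigr => x _; rewrite q1E mulr_suml.
  have E : \sum_(x <- B) \sum_(y <- B) w x y * q1 x =
           \sum_(x <- B) \sum_(y <- B) w x y * q0 y.
    transitivity (\sum_(x <- B) mu x * q1 x).
      by apply: eq_bigr => x _; rewrite mu_q1.
    by apply: eq_bigr => x _; rewrite q1E.
  rewrite -sumrB.
  rewrite -[LHS]addr0 -[X in _ + X](subrr (\sum_(x <- B) \sum_(y <- B) w x y * q0 y)).
  rewrite -{1}E -sumrB -big_split /=; apply: eq_bigr => x _.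
  rewrite -!sumrB -big_split /=; apply: eq_bigr => y _; lra.
apply: ler_sum => x _; apply: ler_sum => y _.
have [->|wn0] := eqVneq (w x y) 0; first by rewrite !mul0r.
by apply: ler_wpM2l => //; apply: sqrt_gap => //; apply: q1_eq0.
Qed.

(** The increment over one step pairs the variation of D^2 with q0 alone;
    adding the next increment replaces q0 y by q0 y - q1 x, which the entropy
    production controls. *)
Lemma nash_step (lam : R) : 0 < lam ->
  M q2 - M q0 <= lam / 2 * (Q q0 - Q q1) + 2 / lam * (M q0 + 2 * M q1 + M q2).
Proof.
move=> lam0.
have M0 : M q0 = \sum_(x <- B) \sum_(y <- B) w x y * D y ^+ 2 * q0 y.
  rewrite exchange_big /=; apply: eq_bigr => x _.
  rewrite -mu_q0 mulr_suml; apply: eq_bigr => y _.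
  by rewrite w_sym mulrAC.
have M1 : M q1 = \sum_(x <- B) \sum_(y <- B) w x y * D x ^+ 2 * q0 y.
  by apply: eq_bigr => x _; rewrite q1E mulr_suml; apply: eq_bigr => y _; rewrite mulrAC.
have M1' : M q1 = \sum_(x <- B) \sum_(y <- B) w x y * D x ^+ 2 * q1 x.
  by apply: eq_bigr => x _; rewrite -mu_q1 mulr_suml; apply: eq_bigr => y _; rewrite mulrAC.
have M2 : M q2 = \sum_(x <- B) \sum_(y <- B) w x y * D y ^+ 2 * q1 x.
  rewrite exchange_big /=; apply: eq_bigr => x _; rewrite q2E mulr_suml.
  by apply: eq_bigr => y _; rewrite w_sym mulrAC.
(* M q1 has two expressions as a double sum, one for each adjacent increment. *)
have -> : M q2 - M q0 = \sum_(x <- B) \sum_(y <- B)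
    w x y * ((D x ^+ 2 - D y ^+ 2) * (q0 y - q1 x)).
  have -> : M q2 - M q0 = (M q1 - M q0) + (M q2 - M q1) by lra.
  rewrite {1}M1 M0 M2 M1' -!sumrB -big_split /=; apply: eq_bigr => x _.
  rewrite -!sumrB -big_split /=; apply: eq_bigr => y _; lra.
have -> : M q0 + 2 * M q1 + M q2 = \sum_(x <- B) \sum_(y <- B)
    w x y * ((D x ^+ 2 + D y ^+ 2) * (q0 y + q1 x)).
  have -> : M q0 + 2 * M q1 + M q2 = (M q1 + M q0) + (M q2 + M q1) by lra.
  rewrite {1}M1 M0 M2 M1' -!big_split /=; apply: eq_bigr => x _.
  rewrite -!big_split /=; apply: eq_bigr => y _; lra.
apply: le_trans (lerD (ler_wpM2l _ hellinger_le_entropy) (lexx _)); last first.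
  by rewrite divr_ge0// ltW.
rewrite !mulr_sumr -big_split /=; apply: ler_sum => x _.
rewrite !mulr_sumr -big_split /=; apply: ler_sum => y _.
have [->|wn0] := eqVneq (w x y) 0; first by rewrite !mul0r !mulr0 addr0.
rewrite (mulrCA (lam / 2)) (mulrCA (2 / lam)) -mulrDr; apply: ler_wpM2l => //.
apply: nash_pointwise => // -[qn0|qn0].
- by apply: D_lip => //; left.
- by rewrite distrC; apply: D_lip; [rewrite w_sym|right].
Qed.
End nash.

(** * Balls and the graph metric *)

Section metric.
Variable g : graph.
Implicit Types x y z : vertex g.

Lemma dist_le0P x y : dist_le x y 0 <-> x = y.
Proof.
split=> [[p [_ <-]]|->]; last by exists [::].
by rewrite leqn0 size_eq0 => /eqP->.
Qed.

Lemma dist_leW m n x y : (m <= n)%N -> dist_le x y m -> dist_le x y n.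
Proof. by move=> mn [p [xp py pm]]; exists p; split=> //; apply: leq_trans mn. Qed.

Lemma dist_le_refl n x : dist_le x x n.
Proof. by exists [::]. Qed.

Lemma dist_le_trans m n x y z :
  dist_le x y m -> dist_le y z n -> dist_le x z (m + n).
Proof.
move=> [p [xp py pm]] [q [yq qz qn]]; exists (p ++ q).
by rewrite cat_path xp py last_cat py size_cat leq_add.
Qed.

Lemma adj_dist_le x y : adj x y -> dist_le x y 1.
Proof. by move=> xy; exists [:: y]; rewrite /= xy. Qed.

Lemma dist_leSP n x y :
  dist_le x y n.+1 <-> x = y \/ exists2 z, adj x z & dist_le z y n.
Proof.
split=> [[[|z p] /= [xp py pn]]|[->|[z xz zy]]]; first by left.
- right; move: xp => /andP[xz zp]; exists z => //; exists p; split => //.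
- exact: dist_le_refl.
- by rewrite -add1n; apply: dist_le_trans zy; apply: adj_dist_le.
Qed.

Lemma dist_le_sym n x y : dist_le x y n -> dist_le y x n.
Proof.
elim: n x => [|n IH] x; first by move=> /dist_le0P ->; exact: dist_le_refl.
move=> /dist_leSP [->|[z xz /IH yz]]; first exact: dist_le_refl.
by rewrite -addn1; apply: dist_le_trans yz _; apply: adj_dist_le; rewrite adj_sym.
Qed.

Lemma gball_finite x n : finite_set (gball x n).
Proof.
elim: n x => [|n IH] x.
  apply: sub_finite_set (finite_set1 x) => y /dist_le0P xy.
  by rewrite /set1/= xy.
apply: (@sub_finite_set _ _ (x |` \bigcup_(z in [set z | adj x z]) gball z n)).
  by move=> y /dist_leSP [->|[z xz zy]]; [left|right; exists z].
rewrite finite_setU; split=> //; apply: bigcup_finite => [|z _]; last exact: IH.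
exact: adj_locally_finite.
Qed.

Definition nbrs x : {fset vertex g} := fset_set [set y | adj x y].

Lemma in_nbrs x y : (y \in nbrs x) = adj x y.
Proof.
rewrite in_fset_set; last exact: adj_locally_finite.
by apply/idP/idP; rewrite in_setE.
Qed.

Definition ball_fset x n : {fset vertex g} := fset_set (gball x n).

Lemma in_ball_fset x n y : (y \in ball_fset x n) <-> dist_le x y n.
Proof. by rewrite in_fset_set ?inE //; exact: gball_finite. Qed.

Lemma degree_eq0 x : degree x = 0%N -> forall y, adj x y = false.
Proof.
by move=> /cardfs0_eq dx y; rewrite -in_nbrs /nbrs dx inE.
Qed.

End metric.

(** * The walk on a fixed rooted graph *)

Section walk.
Context {R : realType}.

(** The Markov operator of the walk; expectations of the walk are its iterates
    at the root, a form in which locality and the Markov property are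
    immediate. *)
Definition avg (g : graph) (F : vertex g -> R) (x : vertex g) : R :=
  if degree x == 0%N then F x
  else (\sum_(y <- nbrs x) F y) / (degree x)%:R.

Arguments avg {g} F x.

Lemma step_prob_ge0 (g : graph) (x y : vertex g) : 0 <= step_prob x y :> R.
Proof.
by rewrite /step_prob; case: ifP => _ //; case: ifP => _ //; rewrite invr_ge0.
Qed.

Lemma step_prob_dist (g : graph) (x y : vertex g) :
  step_prob x y != 0 :> R -> dist_le x y 1.
Proof.
rewrite /step_prob; case: ifP => _.
  by case: (eqVneq x y) => [->|] _; [exact: dist_le_refl|rewrite eqxx].
by case: ifP; [move/adj_dist_le|rewrite eqxx].
Qed.

Lemma sum_step_prob (g : graph) (F : vertex g -> R) (x : vertex g)
  (B : {fset vertex g}) : (forall y, dist_le x y 1 -> y \in B) ->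
  \sum_(y <- B) step_prob x y * F y = avg F x.
Proof.
move=> xB; rewrite /avg; case: ifPn => [dx|dx].
  rewrite (big_fsetD1 x) /=; last by apply: xB; exact: dist_le_refl.
  rewrite /step_prob dx eqxx mul1r big_seq big1 ?addr0// => y.
  by rewrite !inE => /andP[yx _]; rewrite eq_sym (negPf yx) mul0r.
rewrite -(@big_fset_incl _ _ _ _ (nbrs x) B); last 2 first.
- by apply/fsubsetP => y; rewrite in_nbrs => /adj_dist_le /xB.
- by move=> y _; rewrite in_nbrs /step_prob (negPf dx) => /negPf->; rewrite mul0r.
rewrite mulr_suml big_seq [RHS]big_seq; apply: eq_bigr => y.
by rewrite in_nbrs /step_prob (negPf dx) => ->; rewrite mulrC.
Qed.

Section rooted.
Variable g : rooted_graph.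
Local Notation p := (@walk_prob R g).
Local Notation o := (Defs.root g).

Lemma walk_prob_ge0_supp n :
  (forall x, 0 <= p n x) /\ (forall x, p n x != 0 -> dist_le o x n).
Proof.
elim: n => [|n [IH0 IH1]] /=.
  split=> x; first by case: eqP.
  by case: (eqVneq x o) => [-> _|_ /eqP//]; exact/dist_le0P.
have E x : \sum_(y \in [set: vertex g]) p n y * step_prob y x =
    \sum_(y <- ball_fset o n) p n y * step_prob y x.
  rewrite -(fsbig_widen (gball o n)) ?fsbig_finite//; first exact: gball_finite.
  move=> y [_ /= yn]; apply/eqP; rewrite mulf_eq0; apply/orP; left.
  by apply/negP => /negP /IH1.
split=> x; rewrite E.
  by apply: sumr_ge0 => y _; rewrite mulr_ge0// step_prob_ge0.
apply: contraPP => nx /eqP; apply; rewrite big_seq big1// => y /in_ball_fset yn.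
apply/eqP; rewrite mulf_eq0; apply/orP; right; apply/negP => /negP /step_prob_dist yx.
by apply: nx; rewrite -addn1; apply: dist_le_trans yx.
Qed.

Lemma walk_prob_ge0 n x : 0 <= p n x.
Proof. by case: (walk_prob_ge0_supp n). Qed.

Lemma walk_prob_supp n x : p n x != 0 -> dist_le o x n.
Proof. by case: (walk_prob_ge0_supp n) => _; apply. Qed.

Lemma walk_probS n (B : {fset vertex g}) x : (forall y, dist_le o y n -> y \in B) ->
  p n.+1 x = \sum_(y <- B) p n y * step_prob y x.
Proof.
move=> oB /=; rewrite -(fsbig_widen [set` B])//=.
  by rewrite fsbig_finite; [rewrite set_fsetK|exact: finite_fset].
move=> y [_ /= yn]; apply/eqP; rewrite mulf_eq0; apply/orP; left.
by apply/negP => /negP /walk_prob_supp /oB.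
Qed.

(** The forward recursion that defines the law of X_n is dual to the backward
    recursion of [avg]. *)
Lemma walk_expectation n (B : {fset vertex g}) (F : vertex g -> R) :
  (forall y, dist_le o y n -> y \in B) ->
  \sum_(x <- B) p n x * F x = iter n avg F o.
Proof.
elim: n B F => [|n IH] B F oB.
  rewrite (big_fsetD1 o) /=; last by apply: oB; exact: dist_le_refl.
  rewrite eqxx mul1r big_seq big1 ?addr0// => y.
  by rewrite !inE => /andP[/negPf-> _]; rewrite mul0r.
have oB' y : dist_le o y n -> y \in B by move/(dist_leW (leqnSn n)) => /oB.
rewrite iterSr -(IH B)//.
under eq_bigr do rewrite (walk_probS _ oB') mulr_suml.
rewrite exchange_big /= big_seq [RHS]big_seq; apply: eq_bigr => y yB.
under eq_bigr do rewrite -mulrA.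
rewrite -mulr_sumr.
have [->|/walk_prob_supp py] := eqVneq (p n y) 0; first by rewrite !mul0r.
congr (_ * _); apply: sum_step_prob => z yz; apply: oB.
by rewrite -addn1; apply: dist_le_trans yz.
Qed.

Lemma esum_walk n (F : vertex g -> R) : (forall x, 0 <= F x) ->
  (\esum_(x in [set: vertex g]) (p n x * F x)%:E = (iter n avg F o)%:E)%E.
Proof.
move=> F0; rewrite -(@walk_expectation n (ball_fset o n)); last by move=> y /in_ball_fset.
rewrite (_ : \esum_(x in _) _ = \esum_(x in gball o n) (p n x * F x)%:E)%E.
  rewrite esum_fset; [|exact: gball_finite|].
    by rewrite fsbig_finite ?sumEFin//; exact: gball_finite.
  by move=> x _; rewrite lee_fin mulr_ge0// walk_prob_ge0.
rewrite [RHS]esum_mkcond; apply: eq_esum => x _; case: ifPn => //.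
rewrite notin_setE /= => nx; suff -> : p n x = 0 by rewrite mul0r.
by apply: contra_notP nx => /eqP /walk_prob_supp.
Qed.

Lemma iter_avg_ge0 (F : vertex g -> R) n x : (forall x, 0 <= F x) -> 0 <= iter n avg F x.
Proof.
move=> F0; elim: n x => //= n IH x; rewrite {1}/avg; case: ifP => // _.
by rewrite mulr_ge0 ?invr_ge0// sumr_ge0.
Qed.

Lemma iter_avg_cst (c : R) n (x : vertex g) : iter n avg (fun _ => c) x = c.
Proof.
elim: n x => //= n IH x; rewrite {1}/avg; case: ifPn => // dx.
rewrite (eq_bigr (fun _ => c)) // big_const_seq count_predT iter_addr addr0.
by rewrite -(mulr_natr c) mulfK// pnatr_eq0.
Qed.

(** On the component of the root the metric is a natural number, characterized
    by the radii of the balls that contain the point. *)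
Lemma gdist_nat x r : dist_le o x r -> exists2 k : nat, gdist R o x = k%:R%:E &
  forall j, dist_le o x j <-> (k <= j)%N.
Proof.
move=> oxr; have ex : exists k, `[< dist_le o x k >] by exists r; apply/asboolP.
case: (ex_minnP ex) => k /asboolP oxk kmin; exists k; last first.
  by move=> j; split=> [oxj|/dist_leW]; [apply/kmin/asboolP|apply].
apply/eqP; rewrite eq_le; apply/andP; split.
  by apply: ereal_inf_lbound; exists k.
apply: le_ereal_inf_tmp => _ [j oxj <-]; rewrite lee_fin ler_nat; exact/kmin/asboolP.
Qed.

Definition rdist (x : vertex g) : R := fine (gdist R o x).

Lemma rdist_ge0 x : 0 <= rdist x.
Proof.
apply: fine_ge0; apply: le_ereal_inf_tmp => _ [k _ <-]; by rewrite lee_fin ler0n.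
Qed.

Lemma rdist_lip x y r : dist_le o x r -> dist_le x y 1 -> `|rdist x - rdist y| <= 1.
Proof.
move=> ox xy.
have [i xi iP] := gdist_nat ox.
have [j yj jP] := gdist_nat (dist_le_trans ox xy).
rewrite /rdist xi yj /=.
have ij : (j <= i + 1)%N.
  by apply/jP; apply: dist_le_trans xy; apply/iP.
have ji : (i <= j + 1)%N.
  by apply/iP; apply: (dist_le_trans (y := y)); [apply/jP|apply: dist_le_sym].
by rewrite ler_distl lerBlDr -(natrD _ i 1) -(natrD _ j 1) !ler_nat ij ji.
Qed.

Lemma rdist_root : rdist o = 0.
Proof.
have [k ok kP] := gdist_nat (dist_le_refl 0 o).
by rewrite /rdist ok /=; have /kP := dist_le_refl 0 o; rewrite leqn0 => /eqP->.
Qed.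

Lemma mean_sq_displacementE n :
  mean_sq_displacement g n = (iter n avg (fun x => rdist x ^+ 2) o)%:E.
Proof.
rewrite -esum_walk; last by move=> x; rewrite sqr_ge0.
apply: eq_esum => x _.
have [->|/walk_prob_supp ox] := eqVneq (p n x) 0; first by rewrite mul0r mul0e.
have [k xk _] := gdist_nat ox.
by rewrite /rdist xk /= EFinM EFin_expe.
Qed.

Lemma walk_prob_sum n (B : {fset vertex g}) : (forall y, dist_le o y n -> y \in B) ->
  \sum_(x <- B) p n x = 1.
Proof.
move=> oB; rewrite -[RHS](iter_avg_cst 1 n o) -(walk_expectation _ oB).
by apply: eq_bigr => x _; rewrite mulr1.
Qed.

Lemma walk_prob_le1 n x : p n x <= 1.
Proof.
have [->//|/walk_prob_supp ox] := eqVneq (p n x) 0.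
have xB : x \in ball_fset o n by apply/in_ball_fset.
rewrite -(@walk_prob_sum n (ball_fset o n)); last by move=> y /in_ball_fset.
by rewrite (big_fsetD1 x)//= lerDl sumr_ge0// => y _; exact: walk_prob_ge0.
Qed.

Definition entropy n : R := iter n avg (fun x => ln (p n x)^-1) o.

Lemma quenched_entropyE n : quenched_entropy g n = (entropy n)%:E.
Proof.
rewrite -esum_walk // => x.
have [->|px] := eqVneq (p n x) 0; first by rewrite invr0 ln0.
by rewrite ln_ge0// invf_ge1 ?walk_prob_le1// lt_neqAle eq_sym px walk_prob_ge0.
Qed.

Lemma entropy_ge0 n : 0 <= entropy n.
Proof.
rewrite -lee_fin -quenched_entropyE; apply: esum_ge0 => x _.
rewrite lee_fin mulr_ge0 ?walk_prob_ge0//.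
have [->|px] := eqVneq (p n x) 0; first by rewrite invr0 ln0.
by rewrite ln_ge0// invf_ge1 ?walk_prob_le1// lt_neqAle eq_sym px walk_prob_ge0.
Qed.

Lemma entropy0 : entropy 0 = 0.
Proof. by rewrite /entropy /= eqxx invr1 ln1. Qed.

(** Jensen's inequality for ln, here through ln z >= 1 - 1/z with
    z = p_n(x) |B(n)|. *)
Lemma entropy_le n : entropy n <= ln (#|` ball_fset o n|%:R).
Proof.
set m := #|` _|.
have oB y : dist_le o y n -> y \in ball_fset o n by move=> /in_ball_fset.
have m0 : 0 < m%:R :> R.
  rewrite ltr0n cardfs_gt0; apply/fset0Pn; exists o; apply: oB; exact: dist_le_refl.
rewrite /entropy -(walk_expectation _ oB) -subr_ge0.
have -> : ln m%:R = \sum_(x <- ball_fset o n) p n x * ln m%:R.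
  by rewrite -mulr_suml walk_prob_sum// mul1r.
rewrite -sumrB.
rewrite [X in X <= _](_ : _ = \sum_(x <- ball_fset o n) (p n x - m%:R^-1)); last first.
  rewrite sumrB walk_prob_sum// big_const_seq count_predT iter_addr addr0 -/m.
  by rewrite -(mulr_natl (m%:R^-1 : R)) -/m divff ?subrr// gt_eqF.
apply: ler_sum => x _.
have [->|pn0] := eqVneq (p n x) 0.
  by rewrite !mul0r subrr sub0r oppr_le0 invr_ge0.
have px : 0 < p n x by rewrite lt_neqAle eq_sym pn0 walk_prob_ge0.
rewrite lnV ?posrE// mulrN opprK -mulrDr -lnM ?posrE//.
set z := p n x * m%:R; have z0 : 0 < z by rewrite mulr_gt0.
have : ln z^-1 <= z^-1 - 1.
  have := @le_ln1Dx R (z^-1 - 1).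
  by rewrite addrCA subrr addr0; apply; rewrite ltrBrDl subrr invr_gt0.
rewrite lnV ?posrE// => lz.
rewrite -[X in X - _ <= _]mulr1.
have -> : m%:R^-1 = p n x * z^-1 by rewrite /z invfM mulrA divff ?mul1r// gt_eqF.
by rewrite -mulrBr ler_pM2l// mulrC /=; lra.
Qed.
End rooted.
End walk.

Arguments avg {R g} F x.
Arguments rdist {R} g x.
Arguments entropy {R} g n.

(** * Displacement against entropy production on a fixed graph *)

Section quenched.
Context {R : realType}.

(** The reversing measure; the maximum with 1 gives an isolated vertex, where
    the walk stays put, a positive weight. *)
Definition vertex_weight (g : graph) (x : vertex g) : R := (maxn 1 (degree x))%:R.

Definition edge_weight (g : graph) (x y : vertex g) : R :=
  if (x == y) && (degree x == 0%N) then 1 else (adj x y)%:R.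

Lemma vertex_weight_gt0 (g : graph) (x : vertex g) : 0 < vertex_weight x.
Proof. by rewrite ltr0n leq_max. Qed.

Lemma ln_vertex_weight_ge0 (g : graph) (x : vertex g) : 0 <= ln (vertex_weight x).
Proof. by rewrite ln_ge0// ler1n leq_max. Qed.

Lemma edge_weight_sym (g : graph) (x y : vertex g) : edge_weight x y = edge_weight y x.
Proof.
rewrite /edge_weight adj_sym [y == x]eq_sym; case: eqVneq => [->|]//.
Qed.

Lemma edge_weightE (g : graph) (x y : vertex g) :
  vertex_weight x * step_prob x y = edge_weight x y.
Proof.
rewrite /edge_weight /step_prob /vertex_weight; case: (eqVneq (degree x) 0%N) => [dx|dx].
  by rewrite dx andbT mul1r (degree_eq0 dx); case: eqP.
rewrite andbF (maxn_idPr _) ?lt0n//; case: ifP; rewrite ?mulr0// => _.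
by rewrite mulfV// pnatr_eq0.
Qed.

Section rooted.
Variable g : rooted_graph.
Local Notation p := (@walk_prob R g).
Local Notation o := (Defs.root g).

Definition mean_sq_dist n : R := iter n avg (fun x => rdist g x ^+ 2) o.
Definition mean_logdeg n : R := iter n avg (fun x => ln (vertex_weight x)) o.

(** The increment of the entropy of the walk relative to the reversing measure,
    whose expectation is the increment of the plain entropy once
    [mean_logdeg] is known to have constant expectation. *)
Definition entropy_gain n : R :=
  (entropy g n.+1 + mean_logdeg n.+1) - (entropy g n + mean_logdeg n).

Let q n x := p n x / vertex_weight x.

Lemma vertex_weight_density n x : vertex_weight x * q n x = p n x.
Proof. by rewrite /q mulrC divfK// gt_eqF// vertex_weight_gt0. Qed.

Lemma negentropy_density n (B : {fset vertex g}) :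
  (forall y, dist_le o y n -> y \in B) ->
  \sum_(x <- B) vertex_weight x * q n x * ln (q n x) = - (entropy g n + mean_logdeg n).
Proof.
move=> oB; rewrite /entropy /mean_logdeg -!(walk_expectation _ oB) -big_split -sumrN /=.
apply: eq_bigr => x _; rewrite vertex_weight_density /q.
have [->|pn0] := eqVneq (p n x) 0; first by rewrite !mul0r addr0 oppr0.
have px : 0 < p n x by rewrite lt_neqAle eq_sym pn0 walk_prob_ge0.
rewrite lnM ?posrE ?invr_gt0 ?vertex_weight_gt0// !lnV ?posrE ?vertex_weight_gt0//; lra.
Qed.

(** All vertices involved lie in the ball of radius n + 3, so that
    [nash_step] applies with finite sums over that ball. *)
Lemma quenched_step n :
  0 <= entropy_gain n /\ forall lam : R, 0 < lam ->
    mean_sq_dist n.+2 - mean_sq_dist n <= lam / 2 * entropy_gain n +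
      2 / lam * (mean_sq_dist n + 2 * mean_sq_dist n.+1 + mean_sq_dist n.+2).
Proof.
pose B := ball_fset o n.+3.
have oB m y : (m <= n.+3)%N -> dist_le o y m -> y \in B.
  by move=> mn om; apply/in_ball_fset; apply: dist_leW om.
have oBm m : (m <= n.+3)%N -> forall y, dist_le o y m -> y \in B.
  by move=> mn y; apply: oB.
have q_ge0 m x : 0 <= q m x.
  by rewrite /q divr_ge0 ?walk_prob_ge0// ltW// vertex_weight_gt0.
have q_supp m x : q m x != 0 -> dist_le o x m.
  by rewrite /q mulf_eq0 negb_or => /andP[/walk_prob_supp].
have w_ge0 (x y : vertex g) : 0 <= edge_weight x y :> R.
  by rewrite -edge_weightE mulr_ge0 ?step_prob_ge0// ltW// vertex_weight_gt0.
have w_dist (x y : vertex g) : edge_weight x y != 0 :> R -> dist_le x y 1.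
  by rewrite -edge_weightE mulf_eq0 negb_or => /andP[_ /step_prob_dist].
have qS m : (m <= n.+2)%N ->
    forall x, vertex_weight x * q m.+1 x = \sum_(y <- B) edge_weight x y * q m y.
  move=> mn x; rewrite vertex_weight_density (walk_probS _ (oBm m (leqW mn))).
  apply: eq_bigr => y _; rewrite edge_weight_sym -edge_weightE -{1}(vertex_weight_density m y).
  by rewrite mulrAC.
have qmu m : (m <= n.+2)%N ->
    forall x, \sum_(y <- B) edge_weight x y * q m x = vertex_weight x * q m x.
  move=> mn x; have [->|/q_supp ox] := eqVneq (q m x) 0.
    by rewrite mulr0 big1// => y _; rewrite mulr0.
  rewrite -mulr_suml; congr (_ * _).
  under eq_bigr do rewrite -edge_weightE -[step_prob _ _]mulr1.
  rewrite -mulr_sumr (sum_step_prob (fun => 1)); last first.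
    by move=> y xy; apply: (oB m.+1 y mn); rewrite -addn1; apply: dist_le_trans xy.
  by rewrite (_ : avg _ x = 1) ?mulr1//; exact: (iter_avg_cst 1 1%N x).
have D_lip m m' x y : edge_weight x y != 0 :> R -> q m y != 0 \/ q m' y != 0 ->
    `|rdist g x - rdist g y| <= 1 :> R.
  move=> /w_dist xy [] /q_supp oy; rewrite distrC;
    by apply: (rdist_lip oy); apply: dist_le_sym.
have q_eq0 m : (m <= n.+2)%N -> forall x y, edge_weight x y != 0 :> R ->
    q m.+1 x = 0 -> q m y = 0.
  move=> mn x y wxy qx; apply: contraTeq isT => qy.
  have yB : y \in B by apply: (oB m _ (leqW mn)); exact: q_supp.
  have t0 : 0 < edge_weight x y * q m y.
    by rewrite mulr_gt0// lt_neqAle eq_sym ?wxy ?qy ?w_ge0 ?q_ge0.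
  have S0 : 0 <= \sum_(z <- (B `\ y)%fset) edge_weight x z * q m z.
    by apply: sumr_ge0 => z _; rewrite mulr_ge0.
  have := qS m mn x; rewrite qx mulr0 (big_fsetD1 y)//=; lra.
have l1 : (n <= n.+2)%N by lia.
have l2 : (n.+1 <= n.+2)%N by lia.
have ME m : (m <= n.+3)%N ->
    \sum_(x <- B) vertex_weight x * q m x * rdist g x ^+ 2 = mean_sq_dist m.
  move=> mn; rewrite /mean_sq_dist -(walk_expectation _ (oBm m mn)).
  by apply: eq_bigr => x _; rewrite vertex_weight_density.
have l0 : (n <= n.+3)%N by lia.
have l3 : (n.+1 <= n.+3)%N by lia.
have l4 : (n.+2 <= n.+3)%N by lia.
have gE : entropy_gain n = \sum_(x <- B) vertex_weight x * q n x * ln (q n x) -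
     \sum_(x <- B) vertex_weight x * q n.+1 x * ln (q n.+1 x).
  rewrite !negentropy_density; [|exact: oBm..].
  by rewrite /entropy_gain opprK addrC.
split=> [|lam lam0].
  have H := (hellinger_le_entropy w_ge0 (@edge_weight_sym g)
    (q_ge0 n) (q_ge0 n.+1) (qS n l1) (qmu n l1) (qmu n.+1 l2) (q_eq0 n l1)).
  rewrite gE; apply: le_trans H.
  by apply: sumr_ge0 => x _; apply: sumr_ge0 => y _; rewrite mulr_ge0 ?sqr_ge0.
have := nash_step w_ge0 (@edge_weight_sym g) (D_lip n n.+1)
    (q_ge0 n) (q_ge0 n.+1) (qS n l1) (qS n.+1 l2) (qmu n l1) (qmu n.+1 l2)
    (q_eq0 n l1) lam0.
by rewrite !ME// -gE.
Qed.

Lemma entropy_gain_ge0 n : 0 <= entropy_gain n.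
Proof. by have [] := quenched_step n. Qed.

Lemma mean_sq_dist_ge0 n : 0 <= mean_sq_dist n.
Proof. by apply: iter_avg_ge0 => x; rewrite sqr_ge0. Qed.

Lemma mean_sq_dist_le n : mean_sq_dist n <=
  2 + 32 * Num.sqrt n%:R * \sum_(k < n) Num.sqrt k.+1%:R * entropy_gain k.
Proof.
have msd0 : mean_sq_dist 0 = 0 by rewrite /mean_sq_dist /= rdist_root expr0n.
apply: moment_growth; [exact: mean_sq_dist_ge0|exact: entropy_gain_ge0|by rewrite msd0| |].
  have oB y : dist_le o y 1 -> y \in ball_fset o 1 by move/in_ball_fset.
  rewrite /mean_sq_dist -(walk_expectation _ oB) -(walk_prob_sum oB).
  apply: ler_sum => x _.
  have [->|/walk_prob_supp ox] := eqVneq (p 1 x) 0; first by rewrite mul0r.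
  rewrite ler_piMr ?walk_prob_ge0// expr_le1 ?rdist_ge0//.
  have := @rdist_lip R g _ _ _ (dist_le_refl 0 o) ox.
  by rewrite rdist_root sub0r normrN ger0_norm// rdist_ge0.
by move=> n'; case: (quenched_step n').
Qed.
End rooted.
End quenched.

(** * Local functions of a rooted graph *)

Definition is_ball_iso (r : nat) (g h : rooted_graph) (f : vertex g -> vertex h) :=
  [/\ set_bij (gball (Defs.root g) r) (gball (Defs.root h) r) f,
      f (Defs.root g) = Defs.root h
    & {in gball (Defs.root g) r &, forall x y, adj (f x) (f y) = adj x y}].

Section iso.
Variables (g h : rooted_graph) (r : nat) (f : vertex g -> vertex h).
Hypothesis fP : is_ball_iso r f.
Local Notation o := (Defs.root g).

Lemma ball_iso_adj x y : dist_le o x r -> dist_le o y r ->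
  adj (f x) (f y) = adj x y.
Proof. by case: fP => _ _ H ox oy; apply: H; rewrite in_setE. Qed.

Lemma ball_iso_inj x y : dist_le o x r -> dist_le o y r -> f x = f y -> x = y.
Proof. by case: fP => [[_ H _] _ _] ox oy; apply: H; rewrite in_setE. Qed.

Lemma ball_iso_surj y : dist_le (Defs.root h) y r ->
  exists2 x, dist_le o x r & f x = y.
Proof. by case: fP => [[_ _ H] _ _] /H. Qed.

Lemma ball_iso_mem x : dist_le o x r -> dist_le (Defs.root h) (f x) r.
Proof. by case: fP => [[H _ _] _ _] /H. Qed.

Lemma ball_iso_dist i j x y : (i + j <= r)%N -> dist_le o x i ->
  dist_le x y j -> dist_le (f x) (f y) j.
Proof.
elim: j i x => [|j IH] i x ij ox; first by move=> /dist_le0P ->; exact/dist_le0P.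
move=> /dist_leSP [->|[z xz zy]]; first exact: dist_le_refl.
have oz : dist_le o z (i + 1) by apply: dist_le_trans ox _; exact: adj_dist_le.
apply/dist_leSP; right; exists (f z); last by apply: (IH (i + 1)%N z) => //; lia.
by rewrite ball_iso_adj//; [apply: dist_leW ox|apply: dist_leW oz]; lia.
Qed.

Lemma ball_iso_root_dist i x : (i <= r)%N -> dist_le o x i ->
  dist_le (Defs.root h) (f x) i.
Proof.
move=> ir ox; have <- : f o = Defs.root h by case: fP.
by apply: (@ball_iso_dist 0 i) => //; exact: dist_le_refl.
Qed.

Lemma ball_iso_lift i j x y : (i + j <= r)%N -> dist_le o x i ->
  dist_le (f x) y j -> exists2 z, dist_le x z j & f z = y.
Proof.
elim: j i x => [|j IH] i x ij ox.
  by move=> /dist_le0P <-; exists x => //; exact/dist_le0P.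
move=> /dist_leSP [<-|[z fxz zy]]; first by exists x => //; exact: dist_le_refl.
have ofx : dist_le (Defs.root h) (f x) i by apply: ball_iso_root_dist => //; lia.
have [|u ou fu] := @ball_iso_surj z.
  by apply: (@dist_leW _ (i + 1)); [lia|apply: dist_le_trans ofx (adj_dist_le fxz)].
have xu : adj x u.
  by rewrite -(ball_iso_adj _ ou) ?fu//; apply: dist_leW ox; lia.
have ou1 : dist_le o u (i + 1) by apply: dist_le_trans ox _; exact: adj_dist_le.
have [|||v uv fv] := IH (i + 1)%N u; [lia|exact: ou1|by rewrite fu|].
by exists v => //; apply/dist_leSP; right; exists u.
Qed.

(** Paths of length j from a vertex at distance i from the root stay in the
    ball of radius i + j, so that local isomorphism is inherited by the
    smaller balls around other vertices. *)
Lemma ball_iso_recenter i j x : (i + j <= r)%N -> dist_le o x i ->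
  @is_ball_iso j (reroot x) (reroot (f x)) f.
Proof.
move=> ij ox.
have xr y : dist_le x y j -> dist_le o y r.
  by move=> xy; apply: (dist_leW ij); exact: dist_le_trans xy.
split=> //=; last first.
  by move=> y z; rewrite !in_setE /= => xy xz; apply: ball_iso_adj; apply: xr.
split.
- by move=> y /= xy; exact: (ball_iso_dist ij ox xy).
- by move=> y z; rewrite !in_setE /= => xy xz; apply: ball_iso_inj; apply: xr.
- move=> y /= xy; have [z xz zy] := ball_iso_lift ij ox xy; by exists z.
Qed.

Lemma ball_iso_le j : (j <= r)%N -> is_ball_iso j f.
Proof.
move=> jr; have fo : f o = Defs.root h by case: fP.
have H := @ball_iso_recenter 0 j o jr (dist_le_refl 0 o).
by rewrite /is_ball_iso -fo; exact: H.
Qed.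

Lemma ball_iso_nbrs i x : (i < r)%N -> dist_le o x i ->
  nbrs (f x) = [fset f y | y in nbrs x]%fset /\ {in nbrs x &, injective f}.
Proof.
move=> ir ox; have oy y : adj x y -> dist_le o y (i + 1).
  by move=> xy; apply: dist_le_trans ox (adj_dist_le xy).
have oy' y : adj x y -> dist_le o y r by move=> /oy; apply: dist_leW; lia.
have oxr : dist_le o x r by apply: dist_leW ox; lia.
split; last first.
  by move=> y z; rewrite !in_nbrs => xy xz; apply: ball_iso_inj; exact: oy'.
apply/fsetP => y; rewrite in_nbrs; apply/idP/imfsetP => /=.
  move=> fxy; have [|z xz fz] := @ball_iso_lift i 1 x y _ ox (adj_dist_le fxy).
    by lia.
  exists z => //; rewrite in_nbrs -(ball_iso_adj oxr) ?fz//.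
  by apply: (@dist_leW _ (i + 1)); [lia|apply: dist_le_trans xz].
by move=> [z]; rewrite in_nbrs => xz ->; rewrite ball_iso_adj//; exact: oy'.
Qed.

Lemma ball_iso_degree i x : (i < r)%N -> dist_le o x i -> degree (f x) = degree x.
Proof.
move=> ir ox; have [E inj] := ball_iso_nbrs ir ox.
by rewrite /degree -/(nbrs (f x)) E card_in_imfset.
Qed.

Lemma ball_iso_avg (R : realType) (F : vertex g -> R) (F' : vertex h -> R) n i x :
  (i + n <= r)%N -> dist_le o x i ->
  (forall y, dist_le o y (i + n) -> F' (f y) = F y) ->
  iter n avg F' (f x) = iter n avg F x.
Proof.
elim: n i x => [|n IH] i x ir ox FF; first by apply: FF; rewrite addn0.
have ir' : (i < r)%N by lia.
have [E inj] := ball_iso_nbrs ir' ox.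
rewrite !iterS {1}/avg [RHS]/avg (ball_iso_degree ir' ox); case: ifP => _.
  apply: (IH i) => //; first by lia.
  by move=> y oy; apply: FF; apply: dist_leW oy; lia.
congr (_ / _); rewrite E big_imfset//= big_seq [RHS]big_seq.
apply: eq_bigr => y; rewrite in_nbrs => xy.
apply: (IH (i + 1)%N); first by lia.
  exact: dist_le_trans ox (adj_dist_le xy).
by move=> z oz; apply: FF; apply: dist_leW oz; lia.
Qed.

Section real.
Context {R : realType}.

Lemma ball_iso_walk_prob n x : (n <= r)%N -> dist_le o x r ->
  @walk_prob R h n (f x) = @walk_prob R g n x.
Proof.
have E (k : rooted_graph) (y : vertex k) :
    @walk_prob R k n y = iter n avg (fun z => (z == y)%:R) (Defs.root k).
  pose B := (y |` ball_fset (Defs.root k) n)%fset.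
  rewrite -(@walk_expectation _ _ _ B); last first.
    by move=> z /in_ball_fset zB; rewrite !inE zB orbT.
  rewrite (big_fsetD1 y) ?fset1U1//= eqxx mulr1 big_seq big1 ?addr0// => z.
  by rewrite !inE => /andP[/negPf-> _]; rewrite mulr0.
move=> nr ox; rewrite !E.
have <- : f o = Defs.root h by case: fP.
apply: (@ball_iso_avg _ _ _ _ 0) => //; first exact: dist_le_refl.
move=> y oy; congr (_%:R); congr nat_of_bool; apply/eqP/eqP => [|->//].
by apply: ball_iso_inj => //; apply: dist_leW oy; lia.
Qed.

Lemma ball_iso_rdist x : dist_le o x r -> rdist h (f x) = rdist g x :> R.
Proof.
move=> ox; have [k xk kP] := @gdist_nat R _ _ _ ox.
have [l xl lP] := @gdist_nat R _ _ _ (ball_iso_mem ox).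
rewrite /rdist xk xl /=; congr (_%:R); apply/eqP; rewrite eqn_leq.
have kr : (k <= r)%N by apply/kP.
have lr : (l <= r)%N by apply/lP; exact: ball_iso_mem.
apply/andP; split.
  by apply/lP; apply: ball_iso_root_dist => //; apply/kP.
apply/kP.
have : dist_le (f o) (f x) l by case: fP => _ -> _; apply/lP.
move=> /(@ball_iso_lift 0 l _ _ lr (dist_le_refl 0 o)) [z oz fz].
rewrite (@ball_iso_inj x z)//; apply: dist_leW oz => //.
Qed.
End real.
End iso.

Definition local (T : Type) (r : nat) (phi : rooted_graph -> T) :=
  forall g h, ball_iso r g h -> phi h = phi g.

Lemma local_le (T : Type) r r' (phi : rooted_graph -> T) :
  (r <= r')%N -> local r phi -> local r' phi.
Proof. by move=> rr' phir g h [f fP]; apply: phir; exists f; exact: ball_iso_le fP _ _. Qed.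

Section local_walk.
Context {R : realType}.

(** The walk sees after n steps only the balls of radius r around vertices at
    distance at most n from the root. *)
Lemma local_avg n r (phi : rooted_graph -> R) : local r phi ->
  local (n + r) (fun g => iter n avg (fun x => phi (reroot x)) (Defs.root g)).
Proof.
move=> phir g h [f fP]; have <- : f (Defs.root g) = Defs.root h by case: fP.
apply: (ball_iso_avg fP (i := 0)); [lia|exact: dist_le_refl|].
move=> y oy; apply: phir; exists f.
have ij : (0 + n + r <= n + r)%N by lia.
exact: (ball_iso_recenter fP ij oy).
Qed.

Lemma local_ln_vertex_weight : local 1 (fun g => ln (vertex_weight (Defs.root g)) : R).
Proof.
move=> g h [f fP]; have <- : f (Defs.root g) = Defs.root h by case: fP.
by rewrite /vertex_weight (ball_iso_degree fP (i := 0))//; exact: dist_le_refl.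
Qed.

Lemma local_mean_logdeg n : local n.+1 (fun g => mean_logdeg g n : R).
Proof.
rewrite -addn1 => g h gh.
exact: (@local_avg n 1 (fun g => ln (vertex_weight (Defs.root g)))
  local_ln_vertex_weight g h gh).
Qed.

Lemma local_card_ball n :
  local n (fun g => #|` ball_fset (Defs.root g) n|).
Proof.
move=> g h [f fP].
have -> : ball_fset (Defs.root h) n = [fset f x | x in ball_fset (Defs.root g) n]%fset.
  apply/fsetP => y; apply/idP/imfsetP => /= [|[x]].
    move=> /in_ball_fset /(ball_iso_surj fP) [x ox <-].
    by exists x => //; apply/in_ball_fset.
  by move=> /in_ball_fset /(ball_iso_mem fP) oy ->; apply/in_ball_fset.
rewrite card_in_imfset// => x y /in_ball_fset ox /in_ball_fset oy.
exact: (ball_iso_inj fP).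
Qed.

Lemma local_entropy n : local n (fun g => entropy g n : R).
Proof.
move=> g h [f fP]; rewrite /entropy.
have <- : f (Defs.root g) = Defs.root h by case: fP.
apply: (ball_iso_avg fP (i := 0)) => //; first exact: dist_le_refl.
by move=> y oy; rewrite (ball_iso_walk_prob fP).
Qed.

Lemma local_mean_sq_dist n : local n (fun g => mean_sq_dist g n : R).
Proof.
move=> g h [f fP]; rewrite /mean_sq_dist.
have <- : f (Defs.root g) = Defs.root h by case: fP.
apply: (ball_iso_avg fP (i := 0)) => //; first exact: dist_le_refl.
by move=> y oy; rewrite (ball_iso_rdist fP).
Qed.

Lemma local_entropy_gain n : local n.+2 (fun g => entropy_gain g n : R).
Proof.
move=> g h gh; rewrite /entropy_gain.
rewrite (@local_mean_logdeg n.+1 _ _ gh).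
rewrite (local_le (leqnSn _) (@local_mean_logdeg n) gh).
rewrite (local_le (leqnSn _) (@local_entropy n.+1) gh).
by rewrite (local_le (leqW (leqnSn _)) (@local_entropy n) gh).
Qed.
End local_walk.

(** The vertex labels determine a ball up to isomorphism and live in a countable
    type, so balls of radius r have countably many isomorphism classes. *)
Definition ball_code (r : nat) (g : rooted_graph) : nat * seq nat * seq (nat * nat) :=
  let B : seq (vertex g) := ball_fset (Defs.root g) r in
  (val (Defs.root g), [seq val x | x <- B],
   [seq (val z.1, val z.2) | z <- [seq (x, y) | x <- B, y <- B] & adj z.1 z.2]).

Lemma ball_codeP r g h : ball_code r g = ball_code r h -> ball_iso r g h.
Proof.
move=> code; have [ro vs _] := code.
have vsP (k k' : rooted_graph) (x : vertex k) :
    [seq val x | x <- (ball_fset (Defs.root k) r : seq _)] =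
    [seq val x | x <- (ball_fset (Defs.root k') r : seq _)] ->
    dist_le (Defs.root k) x r ->
    exists2 y : vertex k', dist_le (Defs.root k') y r & val y = val x.
  move=> E /in_ball_fset xB.
  have : val x \in [seq val x | x <- (ball_fset (Defs.root k) r : seq _)] by exact: map_f.
  by rewrite E => /mapP [y /in_ball_fset yB ->]; exists y.
pose f (x : vertex g) : vertex h := insubd (Defs.root h) (val x).
have fE x (y : vertex h) : val y = val x -> f x = y.
  by move=> yx; rewrite /f -yx valKd.
have esP (k k' : rooted_graph) (x y : vertex k) (x' y' : vertex k') :
    ball_code r k = ball_code r k' ->
    dist_le (Defs.root k) x r -> dist_le (Defs.root k) y r ->
    val x' = val x -> val y' = val y -> adj x y -> adj x' y'.
  move=> [_ _ E] xB yB xx yy xy.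
  have : (val x, val y) \in [seq (val z.1, val z.2) |
      z <- [seq (x, y) | x <- (ball_fset (Defs.root k) r : seq _),
                         y <- (ball_fset (Defs.root k) r : seq _)] & adj z.1 z.2].
    apply/mapP; exists (x, y) => //; rewrite mem_filter /= xy /=.
    by apply: allpairs_f; apply/in_ball_fset.
  rewrite E => /mapP [[u v]]; rewrite mem_filter /= => /andP[uv _] [xu yv].
  have -> : x' = u by apply: val_inj; exact: etrans xx xu.
  have -> : y' = v by apply: val_inj; exact: etrans yy yv.
  exact: uv.
exists f; split.
- split.
  + by move=> x /(vsP _ h _ vs) [y yB yx]; rewrite /= (fE _ _ yx).
  + move=> x y; rewrite !in_setE /= => /(vsP _ h _ vs) [x' _ xx] /(vsP _ h _ vs) [y' _ yy].
    by rewrite (fE _ _ xx) (fE _ _ yy) => xy; apply: val_inj; rewrite -xx -yy xy.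
  + move=> y /(vsP _ g _ (esym vs)) [x xB xy]; exists x => //.
    by apply: fE.
- by apply: fE; exact: (esym ro).
- move=> x y; rewrite !in_setE /= => xB yB.
  have [x' xB' xx] := vsP _ h _ vs xB; have [y' yB' yy] := vsP _ h _ vs yB.
  rewrite (fE _ _ xx) (fE _ _ yy).
  by apply/idP/idP; [exact: (esP h g _ _ _ _ (esym code))|exact: (esP g h _ _ _ _ code)].
Qed.

(** The preimage is the union, over the countably many codes of balls, of the
    generating events attached to one representative per code. *)
Lemma local_measurable (T : Type) r (phi : rooted_graph -> T) (A : set T) :
  local r phi -> measurable ([set g | A (phi g)] : set rg_space).
Proof.
move=> phir.
pose B c : set rg_space :=
  if pselect (exists g, ball_code r g = c /\ A (phi g)) is left e
  then [set g | ball_iso r (projT1 (cid e)) g] else set0.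
rewrite (_ : [set g | _] = \bigcup_c B c).
  apply: countable_bigcupT_measurable => // c; rewrite /B.
  case: pselect => [e|_]; last exact: measurable0.
  apply: sub_sigma_algebra; exists r => //; exists (projT1 (cid e)) => //.
apply/seteqP; split=> [g Ag|g [c _]].
  exists (ball_code r g) => //; rewrite /B; case: pselect => [e|[]]; last by exists g.
  by case: cid => k [kg _] /=; exact: ball_codeP.
rewrite /B; case: pselect => // e; case: cid => k [_ Ak] /= /phir gk.
by rewrite gk.
Qed.

(** * Averaging over the random graph *)

(** A local function factors through a local function with natural values; this
    reduces integrals of local functions to countable sums over events. *)
Lemma local_index (T : Type) r (phi : rooted_graph -> T) : local r phi ->
  exists2 idx : rooted_graph -> nat, local r idx &
    forall g h, idx g = idx h -> phi g = phi h.
Proof.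
move=> phir.
pose rep (x : T) : rooted_graph := get [set g | phi g = x].
have repP g : phi (rep (phi g)) = phi g.
  by rewrite /rep; apply: (@xgetPex _ _ [set h | phi h = phi g]); exists g.
exists (fun g => choice.pickle (ball_code r (rep (phi g)))).
  by move=> g h /phir ->.
move=> g h /(pcan_inj choice.pickleK) /ball_codeP /phir.
by rewrite !repP.
Qed.

Section annealed.
Context {R : realType} {d : measure_display} {Omega : measurableType d}.
Variables (P : probability Omega R) (G : {RV P >-> rg_space}).

Lemma local_measurable_fun r (phi : rooted_graph -> R) : local r phi ->
  measurable_fun setT (fun w => (phi (G w))%:E : \bar R).
Proof.
move=> phir; apply/measurable_EFinP => _ A mA; rewrite setTI.
exact: (@measurable_funPTI _ _ _ _ G _ (local_measurable A phir)).
Qed.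

Lemma iter_avgZ (g : rooted_graph) n (c : R) (F : vertex g -> R) :
  iter n avg (fun x => c * F x) (Defs.root g) = c * iter n avg F (Defs.root g).
Proof.
have oB y : dist_le (Defs.root g) y n -> y \in ball_fset (Defs.root g) n.
  by move=> /in_ball_fset.
rewrite -!(walk_expectation _ oB) mulr_sumr.
by apply: eq_bigr => x _; rewrite mulrCA.
Qed.

Hypothesis statG : stationary P G.

Lemma stationary_event (A : set rg_space) : measurable A ->
  (\int[P]_w (avg (fun x : vertex (G w) => \1_A (reroot x)) (Defs.root (G w)))%:E =
   \int[P]_w (\1_A (G w))%:E)%E.
Proof.
move=> mA; have := statG mA; rewrite /walk_law => E.
transitivity (\int[P]_w \esum_(x in [set: vertex (G w)])
   (walk_prob 1 x * \1_A (reroot x))%:E)%E.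
  by apply: eq_integral => w _; rewrite (@esum_walk R (G w) 1).
rewrite -E; apply: eq_integral => w _; rewrite (@esum_walk R (G w) 0) //=.
by case: (G w).
Qed.

(** Stationarity is given on events; a local function is a countable
    nonnegative combination of indicators of events. *)
Lemma stationary_step r (phi : rooted_graph -> R) : local r phi ->
  (forall g, 0 <= phi g) ->
  (\int[P]_w (avg (fun x : vertex (G w) => phi (reroot x)) (Defs.root (G w)))%:E =
   \int[P]_w (phi (G w))%:E)%E.
Proof.
move=> phir phi0.
have [idx idxr idxP] := local_index phir.
pose A i : set rg_space := [set g | idx g = i].
(* phi is constant on A i, and c i is its value there. *)
pose c i : R := phi (get [set g | idx g = i]).
pose psi i (g : rooted_graph) : R := c i * \1_(A i) (g : rg_space).
have c0 i : 0 <= c i by exact: phi0.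
have psi0 i g : 0 <= psi i g by rewrite mulr_ge0.
have psir i : local r (psi i).
  move=> g h gh; rewrite /psi !indicE; congr (_ * (nat_of_bool _)%:R).
  by apply/idP/idP; rewrite !in_setE /A /= (idxr _ _ gh).
have phiE g : (phi g)%:E = (\sum_(0 <= i <oo) (psi i g)%:E)%E.
  rewrite (@nneseriesD1 _ _ (idx g)) => [|k _|//]; last by rewrite lee_fin.
  rewrite eseries0 => [|i _ /= ig]; last first.
    rewrite /psi indicE memNset ?mulr0// /A /= => E.
    by move: ig; rewrite E eqxx.
  rewrite adde0 /psi indicE mem_set// mulr1; congr EFin; apply: idxP.
  by apply/esym; apply: (@xgetPex _ _ [set h | idx h = idx g]); exists g.
have avgE (g : rooted_graph) :
    (avg (fun x : vertex g => phi (reroot x)) (Defs.root g))%:E =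
    (\sum_(0 <= i <oo) (avg (fun x : vertex g => psi i (reroot x)) (Defs.root g))%:E)%E.
  have oB y : dist_le (Defs.root g) y 1 -> y \in ball_fset (Defs.root g) 1.
    by move=> /in_ball_fset.
  have E (F : vertex g -> R) : avg F (Defs.root g) = iter 1 avg F (Defs.root g).
    by [].
  rewrite E -(walk_expectation _ oB).
  under eq_eseriesr do rewrite E -(walk_expectation _ oB) -sumEFin.
  rewrite nneseries_sum; last first.
    by move=> x i _; rewrite lee_fin mulr_ge0// walk_prob_ge0.
  rewrite -sumEFin; apply: eq_bigr => x _.
  rewrite EFinM phiE -nneseriesZl//; last by move=> i _; rewrite lee_fin.
have mavg i : measurable_fun setT (fun w =>
    (avg (fun x : vertex (G w) => psi i (reroot x)) (Defs.root (G w)))%:E : \bar R).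
  exact: (@local_measurable_fun (1 + r) (fun g => iter 1 avg
    (fun x => psi i (reroot x)) (Defs.root g)) (@local_avg R 1 r _ (psir i))).
under eq_integral do rewrite avgE.
rewrite integral_nneseries//; last first.
  by move=> i w _; rewrite lee_fin; apply: (@iter_avg_ge0 R (G w) _ 1).
under [RHS]eq_integral do rewrite phiE.
rewrite integral_nneseries//; last 2 first.
- by move=> i; exact: (local_measurable_fun (psir i)).
- by move=> i w _; rewrite lee_fin.
apply: eq_eseriesr => i _.
have mA : measurable (A i).
  exact: (@local_measurable _ _ _ [set i] idxr).
rewrite /psi.
transitivity (\int[P]_w ((c i)%:E *
    (avg (fun x : vertex (G w) => \1_(A i) (reroot x)) (Defs.root (G w)))%:E))%E.
  by apply: eq_integral => w _; rewrite -EFinM; congr EFin; exact: (@iter_avgZ (G w) 1).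
have indr : local r (fun g : rooted_graph => \1_(A i) (g : rg_space) : R).
  move=> g h gh; rewrite !indicE; congr ((nat_of_bool _)%:R).
  by apply/idP/idP; rewrite !in_setE /A /= (idxr _ _ gh).
rewrite ge0_integralZl_EFin//; last 2 first.
- by move=> w _; rewrite lee_fin; apply: (@iter_avg_ge0 R (G w) _ 1).
- exact: (@local_measurable_fun (1 + r) (fun g => iter 1 avg
    (fun x => \1_(A i) (reroot x : rg_space)) (Defs.root g)) (@local_avg R 1 r _ indr)).
rewrite stationary_event// -ge0_integralZl_EFin//.
exact: (local_measurable_fun indr).
Qed.

Lemma mean_logdeg_ge0 g n : 0 <= mean_logdeg g n :> R.
Proof. by apply: iter_avg_ge0 => x; exact: ln_vertex_weight_ge0. Qed.

Lemma integral_mean_logdeg n :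
  (\int[P]_w (mean_logdeg (G w) n)%:E = \int[P]_w (mean_logdeg (G w) 0)%:E)%E.
Proof.
elim: n => // n <-.
rewrite -(@stationary_step n.+1 (fun g => mean_logdeg g n)); last first.
- by move=> g; exact: mean_logdeg_ge0.
- exact: local_mean_logdeg.
by [].
Qed.

Lemma annealed_entropyE n :
  annealed_entropy P G n = (\int[P]_w (entropy (G w) n)%:E)%E.
Proof. by apply: eq_integral => w _; rewrite quenched_entropyE. Qed.

(** Stated additively, so that only integrals of nonnegative functions occur;
    the common term is the expectation of ln deg X_n for any n. *)
Lemma annealed_entropy_gain n :
  (\int[P]_w (entropy_gain (G w) n)%:E +
   (annealed_entropy P G n + \int[P]_w (mean_logdeg (G w) 0)%:E) =
   annealed_entropy P G n.+1 + \int[P]_w (mean_logdeg (G w) 0)%:E)%E.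
Proof.
have ment k : measurable_fun setT (fun w => (entropy (G w) k : R)%:E).
  exact: (local_measurable_fun (@local_entropy R k)).
have mlog k : measurable_fun setT (fun w => (mean_logdeg (G w) k : R)%:E).
  exact: (local_measurable_fun (@local_mean_logdeg R k)).
have HL k : (annealed_entropy P G k + \int[P]_w (mean_logdeg (G w) 0)%:E =
    \int[P]_w ((entropy (G w) k)%:E + (mean_logdeg (G w) k)%:E))%E.
  rewrite annealed_entropyE -(integral_mean_logdeg k) ge0_integralD//.
  - by move=> w _; rewrite lee_fin entropy_ge0.
  - by move=> w _; rewrite lee_fin mean_logdeg_ge0.
rewrite !HL -ge0_integralD//.
- by apply: eq_integral => w _; rewrite -!EFinD /entropy_gain; congr EFin; lra.
- by move=> w _; rewrite lee_fin entropy_gain_ge0.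
- exact: (local_measurable_fun (@local_entropy_gain R n)).
- by move=> w _; rewrite adde_ge0// lee_fin ?entropy_ge0 ?mean_logdeg_ge0.
- exact: emeasurable_funD.
Qed.

Variables (c s : R).
Hypotheses (s0 : 0 <= s).
Hypothesis growth : forall r : nat, (1 <= r)%N ->
  (\int[P]_w (ln (#|` fset_set (gball (Defs.root (G w)) r)|%:R))%:E
   <= (s * ln r%:R + c)%:E)%E.

Lemma measurable_ln_card_ball n : measurable_fun setT
  (fun w => (ln (#|` ball_fset (Defs.root (G w)) n|%:R : R))%:E).
Proof.
apply: (@local_measurable_fun n (fun g => ln (#|` ball_fset (Defs.root g) n|%:R))).
by move=> g h /local_card_ball ->.
Qed.

Lemma annealed_entropy_le n : (0 < n)%N ->
  (annealed_entropy P G n <= (s * ln n%:R + c)%:E)%E.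
Proof.
move=> n0; rewrite annealed_entropyE; apply: le_trans (growth n0).
apply: ge0_le_integral => //.
- by move=> w _; rewrite lee_fin entropy_ge0.
- exact: (local_measurable_fun (@local_entropy R n)).
- exact: measurable_ln_card_ball.
- by move=> w _; rewrite lee_fin entropy_le.
Qed.

Lemma mean_logdeg_le : (\int[P]_w (mean_logdeg (G w) 0)%:E <= c%:E)%E.
Proof.
have := growth (leqnn 1); rewrite ln1 mulr0 add0r; apply: le_trans.
apply: ge0_le_integral => //.
- by move=> w _; rewrite lee_fin mean_logdeg_ge0.
- exact: (local_measurable_fun (@local_mean_logdeg R 0)).
- exact: measurable_ln_card_ball.
move=> w _; rewrite lee_fin /mean_logdeg /= ler_ln ?posrE ?vertex_weight_gt0 ?ltr0n//.
  rewrite /vertex_weight ler_nat geq_max; apply/andP; split.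
    rewrite cardfs_gt0; apply/fset0Pn; exists (Defs.root (G w)).
    by apply/in_ball_fset; exact: dist_le_refl.
  apply: fsubset_leq_card; apply/fsubsetP => y; rewrite in_nbrs => oy.
  by apply/in_ball_fset; exact: adj_dist_le.
rewrite cardfs_gt0; apply/fset0Pn; exists (Defs.root (G w)).
by apply/in_ball_fset; exact: dist_le_refl.
Qed.

Let H n : R := fine (annealed_entropy P G n).

Lemma annealed_entropy_ge0 n : (0 <= annealed_entropy P G n)%E.
Proof.
by rewrite annealed_entropyE; apply: integral_ge0 => w _; rewrite lee_fin entropy_ge0.
Qed.

Lemma annealed_entropy0 : annealed_entropy P G 0 = 0%E.
Proof.
rewrite annealed_entropyE; under eq_integral do rewrite entropy0.
by rewrite integral0.
Qed.

Lemma annealed_entropy_fin n : annealed_entropy P G n = (H n)%:E.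
Proof.
rewrite /H fineK// ge0_fin_numE ?annealed_entropy_ge0//.
case: n => [|n]; first by rewrite annealed_entropy0 ltry.
by apply: le_lt_trans (annealed_entropy_le (ltn0Sn n)) _; rewrite ltry.
Qed.

Lemma integral_entropy_gain n : (\int[P]_w (entropy_gain (G w) n)%:E = (H n.+1 - H n)%:E)%E.
Proof.
have Lfin : (\int[P]_w (mean_logdeg (G w) 0 : R)%:E)%E \is a fin_num.
  rewrite ge0_fin_numE; first by apply: le_lt_trans mean_logdeg_le _; rewrite ltry.
  by apply: integral_ge0 => w _; rewrite lee_fin mean_logdeg_ge0.
have := annealed_entropy_gain n; rewrite !annealed_entropy_fin -(fineK Lfin) -!EFinD => E.
have Gfin : (\int[P]_w (entropy_gain (G w) n : R)%:E)%E \is a fin_num.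
  rewrite ge0_fin_numE; last by apply: integral_ge0 => w _; rewrite lee_fin entropy_gain_ge0.
  by rewrite ltey; apply/eqP => Gy; move: E; rewrite Gy.
move: E; rewrite -(fineK Gfin) -EFinD => -[E]; congr EFin; lra.
Qed.

Lemma annealed_mean_sq_dist_le n : (\int[P]_w (mean_sq_dist (G w) n)%:E <=
  (2 + 32 * Num.sqrt n%:R * \sum_(k < n) Num.sqrt k.+1%:R * (H k.+1 - H k))%:E)%E.
Proof.
have mgain k : measurable_fun setT (fun w => (entropy_gain (G w) k : R)%:E).
  exact: (local_measurable_fun (@local_entropy_gain R k)).
have K0 : 0 <= 32 * Num.sqrt n%:R :> R by rewrite mulr_ge0 ?sqrtr_ge0.
have t0 w k : (0 <= (Num.sqrt k.+1%:R)%:E * (entropy_gain (G w) k : R)%:E)%E.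
  by rewrite -EFinM lee_fin mulr_ge0 ?sqrtr_ge0 ?entropy_gain_ge0.
have mt k : measurable_fun setT
    (fun w => (Num.sqrt k.+1%:R)%:E * (entropy_gain (G w) k : R)%:E)%E.
  exact: measurable_funeM.
apply: (@le_trans _ _ (\int[P]_w (2%:E + (32 * Num.sqrt n%:R)%:E *
    \sum_(k < n) ((Num.sqrt k.+1%:R)%:E * (entropy_gain (G w) k)%:E)))%E).
  apply: ge0_le_integral => //.
  - by move=> w _; rewrite lee_fin mean_sq_dist_ge0.
  - exact: (local_measurable_fun (@local_mean_sq_dist R n)).
  - apply: emeasurable_funD => //; apply: measurable_funeM.
    exact: emeasurable_sum.
  - move=> w _; under eq_bigr do rewrite -EFinM.
    by rewrite sumEFin -EFinM -EFinD lee_fin mean_sq_dist_le.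
rewrite ge0_integralD//; last 2 first.
- by move=> w _; apply: mule_ge0; rewrite ?lee_fin//; apply: sume_ge0 => k _.
- by apply: measurable_funeM; exact: emeasurable_sum.
rewrite integral_cst//= probability_setT mule1.
rewrite ge0_integralZl_EFin//; last 2 first.
- by move=> w _; rewrite sume_ge0.
- exact: emeasurable_sum.
rewrite ge0_integral_sum//.
rewrite (eq_bigr (fun k : 'I_n => (Num.sqrt k.+1%:R * (H k.+1 - H k))%:E)).
  by rewrite sumEFin -EFinM -EFinD.
move=> k _; rewrite EFinM -integral_entropy_gain.
apply: ge0_integralZl_EFin => //.
by move=> w _; rewrite lee_fin entropy_gain_ge0.
Qed.

Lemma markov_mean_sq_dist n (a : R) : 0 < a ->
  (a%:E * P [set w | (a <= mean_sq_dist (G w) n)%R] <= \int[P]_w (mean_sq_dist (G w) n)%:E)%E.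
Proof.
move=> a0.
have := le_integral_abse P measurableT (local_measurable_fun (@local_mean_sq_dist R n)) a0.
rewrite setTI (_ : [set x | _] = [set w | a <= mean_sq_dist (G w) n]); last first.
  by apply/seteqP; split=> w /=; rewrite lee_fin ger0_norm ?mean_sq_dist_ge0.
rewrite (eq_integral (fun w => (mean_sq_dist (G w) n)%:E)) // => w _.
by rewrite gee0_abs// lee_fin mean_sq_dist_ge0.
Qed.

(** At a good time for the increments of the annealed entropy,
    [annealed_mean_sq_dist_le] gives E[M_t] <= 2 + 32 C t. *)
Lemma annealed_good_times : exists2 C : R, 0 < C & forall T : nat,
  exists t : nat, [/\ (T <= t)%N,
    (annealed_entropy P G t.+1 - annealed_entropy P G t <= (C / t.+1%:R)%:E)%E &
    (\int[P]_w (mean_sq_dist (G w) t.+1)%:E <= (C * t.+1%:R)%:E)%E].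
Proof.
have h0 k : 0 <= H k.+1 - H k.
  rewrite -lee_fin -integral_entropy_gain; apply: integral_ge0 => w _.
  by rewrite lee_fin entropy_gain_ge0.
have hsum N : (0 < N)%N -> \sum_(k < N) (H k.+1 - H k) <= s * ln N%:R + c.
  move=> N0; rewrite -(big_mkord xpredT (fun k => H k.+1 - H k)) telescope_sumr//.
  have := annealed_entropy_le N0; rewrite annealed_entropy_fin lee_fin => HN.
  by rewrite {2}/H annealed_entropy0 /= subr0.
have [C C0 CP] := exists_good_times s0 h0 hsum.
exists (2 + 32 * C); first by lra.
move=> T; have [t [Tt ht Bt]] := CP T; exists t.
have t0 : 0 < t.+1%:R :> R by rewrite ltr0n.
split=> //.
  rewrite !annealed_entropy_fin -EFinB lee_fin ler_pdivlMr// mulrC.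
  by apply: le_trans ht _; lra.
apply: le_trans (annealed_mean_sq_dist_le t.+1) _; rewrite lee_fin.
have s2 : Num.sqrt t.+1%:R * Num.sqrt t.+1%:R = t.+1%:R :> R.
  by rewrite -expr2 sqr_sqrtr// ltW.
have t1 : 1 <= t.+1%:R :> R by rewrite ler1n.
apply: (@le_trans _ _ (2 + 32 * Num.sqrt t.+1%:R * (C * Num.sqrt t.+1%:R))).
  by rewrite lerD2l; apply: ler_wpM2l => //; rewrite mulr_ge0 ?sqrtr_ge0.
move: (Num.sqrt _) s2 => r s2; nra.
Qed.
End annealed.

Theorem theorem1p6 (R : realType) (d : measure_display)
    (Omega : measurableType d) (P : probability Omega R)
    (G : {RV P >-> rg_space})
    (G_connected : {ae P, forall w, connected_graph (G w)})
    (G_stationary : stationary P G)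
    (G_growth : weakly_annealed_polynomial_growth P G) :
  forall eps : R, 0 < eps ->
  exists C : R, 0 < C /\
  exists t : nat -> nat,
    [/\ {homo t : m n / (m < n)%N},
        forall n, (0 < t n)%N
      & forall n,
          (annealed_entropy P G (t n) - annealed_entropy P G (t n).-1
             <= (C / (t n)%:R)%:E)%E /\
          ((1 - eps)%:E <=
             P [set w | mean_sq_displacement (G w) (t n)
                          <= (C * (t n)%:R)%:E])%E].
Proof.
move=> eps eps0.
have [c [s [_ s0 growth]]] := G_growth.
have [K K0 KP] := annealed_good_times G_stationary s0 growth.
have [tau tauP] := choice KP.
pose t n := (iter n (fun T => tau T.+1) (tau 0%N)).+1.
have tP n : exists T, t n = (tau T).+1 by case: n => [|n]; eexists.
(* K alone bounds the entropy increments; K / eps is the cost of Markov's inequality. *)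
exists (K + K / eps); split; first by rewrite addr_gt0// divr_gt0.
exists t; split=> //.
  apply: homo_ltn; first exact: ltn_trans.
  move=> n; rewrite /t ltnS /=.
  by have [] := tauP (iter n (fun T => tau T.+1) (tau 0%N)).+1.
move=> n; have [T ->] := tP n; have [_ Hent Hmsd] := tauP T.
set N := (tau T).+1; have N0 : 0 < N%:R :> R by rewrite ltr0n.
split.
  apply: le_trans Hent _; rewrite lee_fin ler_pM2r ?invr_gt0//.
  by rewrite lerDl divr_ge0// ltW.
set a := (K + K / eps) * N%:R.
have a0 : 0 < a by rewrite mulr_gt0// addr_gt0// divr_gt0.
have mA : measurable [set w | a <= mean_sq_dist (G w) N].
  rewrite -[X in measurable X]setTI.
  have := local_measurable_fun G (@local_mean_sq_dist R N).
  move=> /measurable_EFinP /(_ measurableT `[a, +oo[%classic (measurable_itv _)).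
  by congr measurable; apply/seteqP; split=> w /=; rewrite in_itv/= andbT.
have PA : (P [set w | (a <= mean_sq_dist (G w) N)%R] <= eps%:E)%E.
  have := le_trans (markov_mean_sq_dist G N a0) Hmsd.
  have Pfin : P [set w | a <= mean_sq_dist (G w) N] \is a fin_num by exact: fin_num_measure.
  rewrite -(fineK Pfin) -EFinM !lee_fin /a => H.
  set p := fine _ in H *.
  rewrite -/p; apply: contraTT H; rewrite -!ltNge => ep.
  rewrite mulrAC ltr_pM2r// mulrDl.
  have p0 : 0 < p by exact: lt_trans ep.
  apply: (@lt_trans _ _ (K / eps * p)); last by rewrite ltrDr mulr_gt0.
  by rewrite -mulrA ltr_pMr// mulrC ltr_pdivlMr// mul1r.
apply: (@le_trans _ _ (P (~` [set w | (a <= mean_sq_dist (G w) N)%R]))).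
  by rewrite probability_setC// EFinB; apply: leeB.
apply: le_measure; rewrite ?inE; [exact: measurableC| |].
- rewrite -[X in measurable X]setTI.
  have := local_measurable_fun G (@local_mean_sq_dist R N).
  move=> /measurable_EFinP /(_ measurableT `]-oo, a]%classic (measurable_itv _)).
  congr measurable; apply/seteqP; split=> w /=.
    by rewrite mean_sq_displacementE lee_fin in_itv.
  by rewrite mean_sq_displacementE lee_fin in_itv.
- by move=> w /= /negP; rewrite -ltNge mean_sq_displacementE lee_fin => /ltW.
Qed.
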